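(* The semilattice logic $\mathsf{S}$ is undecidable.
   Context: $\mathcal{L}$ is the set of formulas built from a countably infinite set $\mathsf{Prop}$ of propositional letters by $\land,\lor,\to$. A semilattice frame is $(S,\sqcup,0)$ where $\sqcup$ is a commutative, associative, idempotent binary operation on $S$ with identity $0$. A semilattice model adds an arbitrary function $V:\mathsf{Prop}\to\mathcal{P}(S)$, with satisfaction: $x\Vdash p$ iff $x\in V(p)$; $\land,\lor$ pointwise; $x\Vdash\varphi\to\psi$ iff for all $y\in S$, $y\Vdash\varphi$ implies $x\sqcup y\Vdash\psi$. A formula is valid on the frame if it is satisfied at $0$ under every $V$. $\mathsf{S}$ is the set of formulas of $\mathcal{L}$ valid on every semilattice frame. *)

(* Defs.v *)
From Stdlib Require Import Arith Lia Vector Cantor.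
Import VectorNotations.

(** * Formulas and semilattice semantics *)

(** The propositional letters are the natural numbers. *)
Inductive formula : Set :=
| Var : nat -> formula
| And : formula -> formula -> formula
| Or  : formula -> formula -> formula
| Imp : formula -> formula -> formula.

Record semilattice_frame : Type := SemilatticeFrame {
  carrier :> Type;
  join : carrier -> carrier -> carrier;
  zero : carrier;
  join_comm  : forall x y, join x y = join y x;
  join_assoc : forall x y z, join x (join y z) = join (join x y) z;
  join_idem  : forall x, join x x = x;
  join_zero  : forall x, join zero x = x
}.

Arguments join {_} _ _.
Arguments zero {_}.

Fixpoint sat {S : semilattice_frame} (V : nat -> S -> Prop) (x : S)
    (phi : formula) {struct phi} : Prop :=
  match phi with
  | Var p => V p x
  | And a b => sat V x a /\ sat V x b
  | Or a b => sat V x a \/ sat V x b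
  | Imp a b => forall y : S, sat V y a -> sat V (join x y) b
  end.

Definition valid_on (S : semilattice_frame) (phi : formula) : Prop :=
  forall V : nat -> S -> Prop, sat V zero phi.

Definition semilattice_logic (phi : formula) : Prop :=
  forall S : semilattice_frame, valid_on S phi.

(** * Partial recursive functions *)

Inductive recfun : nat -> Set :=
| RZero : recfun 0
| RSucc : recfun 1
| RProj : forall {n}, Fin.t n -> recfun n
| RComp : forall {k n}, recfun k -> Vector.t (recfun n) k -> recfun n
| RPrec : forall {n}, recfun n -> recfun (S (S n)) -> recfun (S n)
| RMin  : forall {n}, recfun (S n) -> recfun n.

(** [eval f v y]: the partial function denoted by [f] is defined at [v], with
    value [y].  Primitive recursion is on the first argument, the step function
    receiving the predecessor, the previous value and the parameters.  In
    [eval_min], [w] witnesses that [f] is defined and nonzero below [y]. *)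
Inductive eval : forall {n}, recfun n -> Vector.t nat n -> nat -> Prop :=
| eval_zero : eval RZero [] 0
| eval_succ : forall x, eval RSucc [x] (S x)
| eval_proj : forall n (i : Fin.t n) v, eval (RProj i) v (Vector.nth v i)
| eval_comp : forall k n (f : recfun k) (gs : Vector.t (recfun n) k) v w y,
    (forall i, eval (Vector.nth gs i) v (Vector.nth w i)) ->
    eval f w y ->
    eval (RComp f gs) v y
| eval_prec0 : forall n (f : recfun n) g v y,
    eval f v y ->
    eval (RPrec f g) (0 :: v) y
| eval_precS : forall n (f : recfun n) g m v z y,
    eval (RPrec f g) (m :: v) z ->
    eval g (m :: z :: v) y ->
    eval (RPrec f g) (S m :: v) y
| eval_min : forall n (f : recfun (S n)) v (w : nat -> nat) y,
    (forall m, m < y -> eval f (m :: v) (S (w m))) ->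
    eval f (y :: v) 0 ->
    eval (RMin f) v y.

(** * Decidability of a set of formulas *)

(** Goedel numbering; [Cantor.to_nat] is the Cantor pairing bijection. *)
Fixpoint code (phi : formula) : nat :=
  match phi with
  | Var p => 4 * p
  | And a b => 4 * Cantor.to_nat (code a, code b) + 1
  | Or a b => 4 * Cantor.to_nat (code a, code b) + 2
  | Imp a b => 4 * Cantor.to_nat (code a, code b) + 3
  end.

Lemma code_inj : forall phi psi, code phi = code psi -> phi = psi.
Proof.
  induction phi as [p|a IHa b IHb|a IHa b IHb|a IHa b IHb];
    intros [q|c d|c d|c d] H; cbn [code] in H; try (exfalso; lia).
  - f_equal; lia.
  - assert (E : (code a, code b) = (code c, code d))
      by (apply Cantor.to_nat_inj; lia).
    injection E as E1 E2. f_equal; auto.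
  - assert (E : (code a, code b) = (code c, code d))
      by (apply Cantor.to_nat_inj; lia).
    injection E as E1 E2. f_equal; auto.
  - assert (E : (code a, code b) = (code c, code d))
      by (apply Cantor.to_nat_inj; lia).
    injection E as E1 E2. f_equal; auto.
Qed.

Lemma code_surj : forall n, exists phi, code phi = n.
Proof.
  induction n as [n IH] using lt_wf_ind.
  pose proof (Nat.div_mod_eq n 4) as E.
  pose proof (Nat.mod_upper_bound n 4 ltac:(lia)) as B.
  set (q := n / 4) in *. set (r := n mod 4) in *.
  destruct (Nat.eq_dec r 0) as [R0|R0].
  { exists (Var q). cbn [code]. lia. }
  destruct (Cantor.of_nat q) as [a b] eqn:Q.
  assert (Hq : Cantor.to_nat (a, b) = q)
    by (rewrite <- Q; apply Cantor.cancel_to_of).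
  pose proof (Cantor.to_nat_non_decreasing a b) as L.
  destruct (IH a ltac:(lia)) as [phi Hphi].
  destruct (IH b ltac:(lia)) as [psi Hpsi].
  assert (r = 1 \/ r = 2 \/ r = 3) as [R|[R|R]] by lia.
  - exists (And phi psi). cbn [code]. rewrite Hphi, Hpsi, Hq. lia.
  - exists (Or phi psi). cbn [code]. rewrite Hphi, Hpsi, Hq. lia.
  - exists (Imp phi psi). cbn [code]. rewrite Hphi, Hpsi, Hq. lia.
Qed.

(** The characteristic function of [L] is recursive.  Since [code] is a
    bijection onto [nat], the function [f] is then total. *)
Definition decidable_logic (L : formula -> Prop) : Prop :=
  exists f : recfun 1, forall phi : formula,
    (L phi -> eval f [code phi] 1) /\ (~ L phi -> eval f [code phi] 0).

Definition undecidable_logic (L : formula -> Prop) : Prop :=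
  ~ decidable_logic L.

(* Main.v *)
(** A decision procedure for the logic would, through a register machine, refute
    itself.  Suppose [f] decides it.  For a register machine [P] there is a formula
    [psi] such that, for all inputs [n], [input_formula n -> psi] is valid if [P]
    started on [n] halts in its accepting state, and invalid if it stops in another
    state.  As the code of [input_formula m -> psi] is computable from [m = code psi],
    one may take for [P] the machine that on input [m] accepts if and only if [f]
    rejects [input_formula m -> psi]; running it on [code psi] is contradictory.

    A point refuting [psi] is the origin of a grid.  The axiom "if (A_0 -> ... ->
    A_(D-1) -> E') then E", read contrapositively, turns a point where E fails into
    a larger one where E' fails, by joining one generator in each of [D] directions;
    so it yields arbitrarily long chains of generators in every direction, and the
    joins of their initial segments form the grid [nat ^ D].  All other axioms are
    Horn clauses that propagate letters upwards along this grid.  Since joins only go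
    up, a register is represented by two directions, as a number of increments minus
    a number of decrements, and the letters "zero" and "positive" are propagated
    from the diagonal of the corresponding plane.  The halting letter is inherited
    upwards and implies E, hence cannot occur.  Conversely, if the machine does not
    accept, sets of generators under union form a model.  A join with a generator
    that is not the next one either changes nothing or destroys the initial segment;
    this is why the letters record the parity of each coordinate, which changes
    only in a proper step. *)

Require Import Defs.
From Stdlib Require Import Arith Lia Bool List Cantor Relations.
From Stdlib Require Import FunctionalExtensionality Classical.
Import Vector.VectorNotations ListNotations.
Local Open Scope list_scope.

(** * Recursive functions *)

Definition computable (F : nat -> nat) : Prop :=
  exists f : recfun 1, forall x, eval f [x]%vector (F x).

Fixpoint const_rec (n c : nat) : recfun n :=
  match c with
  | 0 => RComp RZero []%vector
  | S c => RComp RSucc [const_rec n c]%vector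
  end.

Lemma eval_const n c v : eval (const_rec n c) v c.
Proof.
  induction c as [|c IH]; cbn.
  - apply eval_comp with (w := []%vector); [|constructor].
    intros i; apply (Fin.case0 (fun _ => _) i).
  - apply eval_comp with (w := [c]%vector); [|constructor].
    intros i; apply (Fin.caseS' i); [exact IH|].
    intros j; apply (Fin.case0 (fun _ => _) j).
Qed.

Lemma eval_comp1 n (f : recfun 1) (g : recfun n) v x y :
  eval g v x -> eval f [x]%vector y -> eval (RComp f [g]%vector) v y.
Proof.
  intros Hg Hf. apply eval_comp with (w := [x]%vector); [|exact Hf].
  intros i; apply (Fin.caseS' i); [exact Hg|].
  intros j; apply (Fin.case0 (fun _ => _) j).
Qed.

Lemma eval_comp2 n (f : recfun 2) (g h : recfun n) v x y z :
  eval g v x -> eval h v y -> eval f [x; y]%vector z ->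
  eval (RComp f [g; h]%vector) v z.
Proof.
  intros Hg Hh Hf. apply eval_comp with (w := [x; y]%vector); [|exact Hf].
  intros i; apply (Fin.caseS' i); [exact Hg|].
  intros j; apply (Fin.caseS' j); [exact Hh|].
  intros k; apply (Fin.case0 (fun _ => _) k).
Qed.

Definition add_rec : recfun 2 :=
  RPrec (RProj Fin.F1) (RComp RSucc [RProj (Fin.FS Fin.F1)]%vector).

Lemma eval_add x y : eval add_rec [x; y]%vector (x + y).
Proof.
  induction x as [|x IH].
  - apply eval_prec0. exact (eval_proj _ Fin.F1 [y]%vector).
  - eapply eval_precS; [exact IH|].
    eapply eval_comp1; [|apply eval_succ].
    exact (eval_proj _ (Fin.FS Fin.F1) [x; x + y; y]%vector).
Qed.

Lemma computable_const c : computable (fun _ => c).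
Proof. exists (const_rec 1 c). intros x. apply eval_const. Qed.

Lemma computable_id : computable (fun x => x).
Proof.
  exists (RProj Fin.F1). intros x. exact (eval_proj _ Fin.F1 [x]%vector).
Qed.

Lemma computable_comp F G :
  computable F -> computable G -> computable (fun x => F (G x)).
Proof.
  intros [f Hf] [g Hg]. exists (RComp f [g]%vector). intros x.
  eapply eval_comp1; [apply Hg|apply Hf].
Qed.

Lemma computable_add F G :
  computable F -> computable G -> computable (fun x => F x + G x).
Proof.
  intros [f Hf] [g Hg]. exists (RComp add_rec [f; g]%vector). intros x.
  eapply eval_comp2; [apply Hf|apply Hg|apply eval_add].
Qed.

Lemma computable_iter c F :
  computable F -> computable (fun n => Nat.iter n F c).
Proof.
  intros [f Hf].
  exists (RPrec (const_rec 0 c) (RComp f [RProj (Fin.FS Fin.F1)]%vector)).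
  intros x. induction x as [|x IH].
  - apply eval_prec0, eval_const.
  - eapply eval_precS; [exact IH|]. eapply eval_comp1; [|apply Hf].
    exact (eval_proj _ (Fin.FS Fin.F1) [x; Nat.iter x F c]%vector).
Qed.

(** The triangular numbers, in the very form of the recursion inside [Cantor.to_nat], so that
    [computable_pair] can apply it directly. *)
Lemma computable_triangle :
  computable (nat_rec (fun _ => nat) 0 (fun i m => S i + m)).
Proof.
  exists (RPrec (const_rec 0 0)
    (RComp add_rec [RComp RSucc [RProj Fin.F1]; RProj (Fin.FS Fin.F1)]%vector)).
  intros x. induction x as [|x IH].
  - apply eval_prec0, eval_const.
  - eapply eval_precS; [exact IH|]. eapply eval_comp2; [| |apply eval_add].
    + eapply eval_comp1; [|apply eval_succ].
      exact (eval_proj _ Fin.F1 [x; _]%vector).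
    + exact (eval_proj _ (Fin.FS Fin.F1) [x; _]%vector).
Qed.

Lemma computable_pair F G :
  computable F -> computable G ->
  computable (fun x => Cantor.to_nat (F x, G x)).
Proof.
  intros HF HG.
  apply (computable_add G
    (fun x => nat_rec (fun _ => nat) 0 (fun i m => S i + m) (G x + F x)) HG).
  apply (computable_comp _ (fun x => G x + F x)).
  - apply computable_triangle.
  - now apply computable_add.
Qed.

Lemma computable_node c F G :
  computable F -> computable G ->
  computable (fun x => 4 * Cantor.to_nat (F x, G x) + c).
Proof.
  intros HF HG. pose proof (computable_pair F G HF HG) as HP.
  apply computable_add; [|apply computable_const].
  (* The factor 4 unfolds to a sum of four copies and a final [0]. *)
  repeat (apply computable_add; [exact HP|]). apply computable_const.
Qed.

(** * From recursive functions to register machines *)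

Definition state := nat -> nat.

Definition upd (s : state) (r v : nat) : state :=
  fun q => if q =? r then v else s q.

Lemma upd_eq s r v : upd s r v r = v.
Proof. unfold upd. now rewrite Nat.eqb_refl. Qed.

Lemma upd_neq s r v q : q <> r -> upd s r v q = s q.
Proof. intros H. unfold upd. now apply Nat.eqb_neq in H as ->. Qed.

(** Structured while programs, halfway between recursive functions and machines. [Loop r c] takes
    one from [r] before each pass through [c] and ends when [r] is zero. *)
Inductive prog : Set :=
| Skip : prog
| Inc : nat -> prog
| Seq : prog -> prog -> prog
| Loop : nat -> prog -> prog.

Inductive exec : prog -> state -> state -> Prop :=
| exec_skip s : exec Skip s s
| exec_inc r s : exec (Inc r) s (upd s r (S (s r)))
| exec_seq c d s1 s2 s3 : exec c s1 s2 -> exec d s2 s3 -> exec (Seq c d) s1 s3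
| exec_loop0 r c s : s r = 0 -> exec (Loop r c) s s
| exec_loopS r c m s1 s2 s3 :
    s1 r = S m -> exec c (upd s1 r m) s2 -> exec (Loop r c) s2 s3 ->
    exec (Loop r c) s1 s3.

Definition clear (r : nat) : prog := Loop r Skip.

Lemma exec_clear r s :
  exists s', exec (clear r) s s' /\ s' r = 0 /\ forall q, q <> r -> s' q = s q.
Proof.
  remember (s r) as m eqn:E. revert s E.
  induction m as [|m IH]; intros s E.
  - exists s. split; [now apply exec_loop0|]. split; auto.
  - destruct (IH (upd s r m)) as (s' & H1 & H2 & H3); [now rewrite upd_eq|].
    exists s'. split; [eapply exec_loopS; eauto using exec_skip|].
    split; [exact H2|]. intros q Hq. rewrite H3 by exact Hq. now apply upd_neq.
Qed.

(** Reading a register empties it, so [a] is drained into both [b] and the scratch register [t],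
    then refilled from [t]. *)
Definition copy (a b t : nat) : prog :=
  Seq (clear b) (Seq (clear t)
    (Seq (Loop a (Seq (Inc b) (Inc t))) (Loop t (Inc a)))).

Lemma exec_copy a b t s :
  a <> b -> a <> t -> b <> t ->
  exists s', exec (copy a b t) s s' /\ s' b = s a /\
    forall q, q <> b -> q <> t -> s' q = s q.
Proof.
  intros ab at' bt.
  assert (L1 : forall m s, s a = m -> exists s',
    exec (Loop a (Seq (Inc b) (Inc t))) s s' /\ s' a = 0 /\
    s' b = s b + m /\ s' t = s t + m /\
    forall q, q <> a -> q <> b -> q <> t -> s' q = s q).
  { induction m as [|m IH]; intros s1 E.
    - exists s1. split; [now apply exec_loop0|]. auto with arith.
    - set (s2 := upd s1 a m).
      set (s3 := upd s2 b (S (s2 b))). set (s4 := upd s3 t (S (s3 t))).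
      assert (F : s4 a = m /\ s4 b = S (s1 b) /\ s4 t = S (s1 t) /\
        forall q, q <> a -> q <> b -> q <> t -> s4 q = s1 q).
      { subst s4 s3 s2. repeat split; intros;
          repeat (rewrite upd_eq || rewrite upd_neq by auto); auto. }
      destruct F as (F1 & F2 & F3 & F4).
      destruct (IH s4 F1) as (s' & X & Xa & Xb & Xt & Xq).
      exists s'. split.
      { eapply exec_loopS; [exact E| |exact X].
        eapply exec_seq; apply exec_inc. }
      split; [exact Xa|]. split; [lia|]. split; [lia|].
      intros q ? ? ?. rewrite Xq; auto. }
  assert (L2 : forall m s, s t = m -> exists s',
    exec (Loop t (Inc a)) s s' /\ s' a = s a + m /\
    forall q, q <> a -> q <> t -> s' q = s q).
  { induction m as [|m IH]; intros s1 E.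
    - exists s1. split; [now apply exec_loop0|]. auto with arith.
    - set (s2 := upd s1 t m). set (s3 := upd s2 a (S (s2 a))).
      assert (F : s3 t = m /\ s3 a = S (s1 a) /\
        forall q, q <> a -> q <> t -> s3 q = s1 q).
      { subst s3 s2. repeat split; intros;
          repeat (rewrite upd_eq || rewrite upd_neq by auto); auto. }
      destruct F as (F1 & F2 & F3).
      destruct (IH s3 F1) as (s' & X & Xa & Xq).
      exists s'. split.
      { eapply exec_loopS; [exact E| |exact X]. apply exec_inc. }
      split; [lia|]. intros q ? ?. rewrite Xq; auto. }
  destruct (exec_clear b s) as (s1 & X1 & B1 & Q1).
  destruct (exec_clear t s1) as (s2 & X2 & B2 & Q2).
  destruct (L1 _ s2 eq_refl) as (s3 & X3 & A3 & B3 & T3 & Q3).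
  destruct (L2 _ s3 eq_refl) as (s4 & X4 & A4 & Q4).
  exists s4. split; [repeat (eapply exec_seq; eauto)|].
  assert (Ea : s2 a = s a) by (rewrite Q2, Q1; auto).
  split.
  - rewrite Q4, B3, (Q2 b), B1 by auto. lia.
  - intros q qb qt. destruct (Nat.eq_dec q a) as [->|qa].
    + rewrite A4, A3, T3, B2. lia.
    + rewrite Q4, Q3, Q2, Q1; auto.
Qed.

(** * Compilation of recursive functions into loop programs *)

Fixpoint viota (o k : nat) : Vector.t nat k :=
  match k with
  | 0 => []%vector
  | S k => (o :: viota (S o) k)%vector
  end.

Lemma viota_bound k : forall o i, o <= Vector.nth (viota o k) i < o + k.
Proof.
  induction k as [|k IH]; intros o i.
  - apply (Fin.case0 (fun _ => _) i).
  - apply (Fin.caseS' i); cbn; [lia|]. intros j. specialize (IH (S o) j). lia.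
Qed.

(** [compile f args out fr] leaves [f (args)] in register [out]; all registers
    from [fr] on are scratch space. *)
Fixpoint compile {n} (f : recfun n) :
    Vector.t nat n -> nat -> nat -> prog :=
  match f in recfun n return Vector.t nat n -> nat -> nat -> prog with
  | RZero => fun _ out _ => clear out
  | RSucc => fun args out fr => Seq (copy (Vector.hd args) out fr) (Inc out)
  | RProj i => fun args out fr => copy (Vector.nth args i) out fr
  | @RComp k n f gs => fun args out fr =>
      Seq ((fix go {j} (gs : Vector.t (recfun n) j) (o : nat) : prog :=
              match gs with
              | Vector.nil _ => Skip
              | Vector.cons _ g _ gs =>
                  Seq (compile g args o (fr + k)) (go gs (S o))
              end) k gs fr)
          (compile f (viota fr k) out (fr + k))
  | RPrec f g => fun args out fr =>
      Seq (compile f (Vector.tl args) (fr + 2) (fr + 4))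
      (Seq (copy (Vector.hd args) fr (fr + 3))
      (Seq (clear (fr + 1))
      (Seq (Loop fr
             (Seq (compile g (fr + 1 :: fr + 2 :: Vector.tl args)%vector
                    (fr + 3) (fr + 4))
             (Seq (copy (fr + 3) (fr + 2) (fr + 4)) (Inc (fr + 1)))))
        (copy (fr + 2) out (fr + 3)))))
  | RMin f => fun args out fr =>
      Seq (clear fr)
      (Seq (compile f (fr :: args)%vector (fr + 1) (fr + 2))
      (Seq (Loop (fr + 1)
             (Seq (Inc fr) (compile f (fr :: args)%vector (fr + 1) (fr + 2))))
        (copy fr out (fr + 2))))
  end.

(** [out] is kept apart from the arguments because [copy] clears its target before reading its
    source. The scratch registers may hold leftovers of earlier calls. *)
Definition compiled {n} (f : recfun n) (v : Vector.t nat n) (y : nat) : Prop :=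
  forall args out fr s,
    (forall i, Vector.nth args i < fr /\ Vector.nth args i <> out /\
               s (Vector.nth args i) = Vector.nth v i) ->
    out < fr ->
    exists s', exec (compile f args out fr) s s' /\ s' out = y /\
      forall q, q < fr -> q <> out -> s' q = s q.

Lemma nth_tl {A n} (v : Vector.t A (S n)) i :
  Vector.nth (Vector.tl v) i = Vector.nth v (Fin.FS i).
Proof. apply (Vector.caseS' v). reflexivity. Qed.

Lemma nth_hd {A n} (v : Vector.t A (S n)) :
  Vector.hd v = Vector.nth v Fin.F1.
Proof. apply (Vector.caseS' v). reflexivity. Qed.

Lemma compiled_comp k n (f : recfun k) (gs : Vector.t (recfun n) k) v w y :
  (forall i, compiled (Vector.nth gs i) v (Vector.nth w i)) ->
  compiled f w y -> compiled (RComp f gs) v y.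
Proof.
  intros Hgs Hf args out fr s Hargs Hout. cbn [compile].
  (* Naming the inner fixpoint permits induction on the vector; [o] is the register that receives
     the next intermediate value. *)
  set (go := fix go {j} (gs : Vector.t (recfun n) j) (o : nat) : prog :=
    match gs with
    | Vector.nil _ => Skip
    | Vector.cons _ g _ gs => Seq (compile g args o (fr + k)) (go gs (S o))
    end).
  assert (G : forall j (gs : Vector.t (recfun n) j) (w : Vector.t nat j) o s,
    (forall i, compiled (Vector.nth gs i) v (Vector.nth w i)) ->
    (forall i, Vector.nth args i < fr /\ Vector.nth args i <> out /\
               s (Vector.nth args i) = Vector.nth v i) ->
    fr <= o -> o + j <= fr + k ->
    exists s', exec (go j gs o) s s' /\
      (forall i, s' (Vector.nth (viota o j) i) = Vector.nth w i) /\
      (forall q, q < o -> s' q = s q)).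
  { clear Hgs Hf Hargs s gs w.
    induction gs as [|g j gs IH]; intros w o s Hgs Hargs H1 H2.
    - exists s. cbn. split; [apply exec_skip|]. split; [|auto].
      intros i; apply (Fin.case0 (fun _ => _) i).
    - destruct (Hgs Fin.F1 args o (fr + k) s) as (s1 & X1 & Y1 & Q1).
      { intros i. destruct (Hargs i) as (? & ? & ?). repeat split; auto; lia. }
      { lia. }
      destruct (IH (Vector.tl w) (S o) s1) as (s2 & X2 & Y2 & Q2).
      { intros i. rewrite nth_tl. exact (Hgs (Fin.FS i)). }
      { intros i. destruct (Hargs i) as (? & ? & ?).
        repeat split; auto. rewrite Q1; auto; lia. }
      { lia. } { lia. }
      exists s2. split; [cbn; eapply exec_seq; eauto|]. split.
      + intros i; apply (Fin.caseS' i); cbn.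
        * rewrite Q2 by lia. exact Y1.
        * intros l. rewrite Y2, nth_tl. reflexivity.
      + intros q Hq. rewrite Q2, Q1 by lia. reflexivity. }
  destruct (G k gs w fr s Hgs Hargs) as (s1 & X1 & Y1 & Q1); [lia|lia|].
  destruct (Hf (viota fr k) out (fr + k) s1) as (s2 & X2 & Y2 & Q2).
  { intros i. pose proof (viota_bound k fr i). repeat split; auto; lia. }
  { lia. }
  exists s2. split; [eapply exec_seq; eauto|]. split; [exact Y2|].
  intros q H1 H2. rewrite Q2, Q1 by lia. reflexivity.
Qed.

(** Here [z] is the course of values. Register [fr] holds the number of rounds left, [fr + 1] the
    index, [fr + 2] the current value and [fr + 3] the next one. *)
Lemma compiled_prec n (f : recfun n) (g : recfun (S (S n))) v m z :
  compiled f v (z 0) ->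
  (forall i, i < m -> compiled g (i :: z i :: v)%vector (z (S i))) ->
  compiled (RPrec f g) (m :: v)%vector (z m).
Proof.
  intros Hf Hg args out fr s Hargs Hout. cbn [compile].
  assert (Ht : forall i, Vector.nth (Vector.tl args) i < fr /\
    Vector.nth (Vector.tl args) i <> out /\
    s (Vector.nth (Vector.tl args) i) = Vector.nth v i).
  { intros i. rewrite nth_tl. exact (Hargs (Fin.FS i)). }
  destruct (Hargs Fin.F1) as (A1 & A2 & A3). rewrite <- nth_hd in A1, A2, A3.
  cbn in A3.
  set (a := Vector.hd args) in *. set (tl := Vector.tl args) in *.
  clearbody a tl.
  assert (L : forall c i s, i + c = m -> s fr = c -> s (fr + 1) = i ->
    s (fr + 2) = z i -> (forall i, s (Vector.nth tl i) = Vector.nth v i) ->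
    exists s', exec (Loop fr
      (Seq (compile g (fr + 1 :: fr + 2 :: tl)%vector (fr + 3) (fr + 4))
      (Seq (copy (fr + 3) (fr + 2) (fr + 4)) (Inc (fr + 1))))) s s' /\
      s' (fr + 2) = z m /\ forall q, q < fr -> s' q = s q).
  { induction c as [|c IH]; intros i s0 E1 E2 E3 E4 E5.
    - exists s0. split; [now apply exec_loop0|]. split; [|auto].
      rewrite E4. f_equal. lia.
    - set (s1 := upd s0 fr c).
      assert (E5' : forall j, s1 (Vector.nth tl j) = Vector.nth v j).
      { intros j. unfold s1. rewrite upd_neq; [apply E5|].
        specialize (Ht j). lia. }
      destruct (Hg i ltac:(lia) (fr + 1 :: fr + 2 :: tl)%vector
        (fr + 3) (fr + 4) s1) as (s2 & X2 & Y2 & Q2).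
      { intros j. apply (Fin.caseS' j); cbn.
        - unfold s1. rewrite upd_neq by lia. lia.
        - clear j. intros j. apply (Fin.caseS' j); cbn.
          + unfold s1. rewrite upd_neq by lia. lia.
          + clear j. intros j. specialize (Ht j). rewrite E5'. lia. }
      { lia. }
      destruct (exec_copy (fr + 3) (fr + 2) (fr + 4) s2)
        as (s3 & X3 & Y3 & Q3); [lia..|].
      set (s4 := upd s3 (fr + 1) (S (s3 (fr + 1)))).
      assert (Q4 : forall q, q < fr -> s4 q = s0 q).
      { intros q Hq. unfold s4. rewrite upd_neq, Q3, Q2 by lia.
        unfold s1. now rewrite upd_neq by lia. }
      destruct (IH (S i) s4) as (s' & X & Y & Q).
      + lia.
      + unfold s4. rewrite upd_neq, Q3, Q2 by lia. apply upd_eq.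
      + unfold s4. rewrite upd_eq, Q3, Q2 by lia.
        unfold s1. rewrite upd_neq by lia. lia.
      + unfold s4. rewrite upd_neq, Y3 by lia. exact Y2.
      + intros j. rewrite Q4; [apply E5|]. apply Ht.
      + exists s'. split.
        { eapply exec_loopS; [exact E2| |exact X].
          eapply exec_seq; [exact X2|]. eapply exec_seq; [exact X3|].
          apply exec_inc. }
        split; [exact Y|]. intros q Hq. rewrite Q, Q4 by exact Hq. reflexivity. }
  destruct (Hf tl (fr + 2) (fr + 4) s) as (s1 & X1 & Y1 & Q1).
  { intros j. specialize (Ht j). repeat split; try lia. }
  { lia. }
  destruct (exec_copy a fr (fr + 3) s1) as (s2 & X2 & Y2 & Q2); [lia..|].
  destruct (exec_clear (fr + 1) s2) as (s3 & X3 & Y3 & Q3).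
  destruct (L m 0 s3) as (s4 & X4 & Y4 & Q4).
  - reflexivity.
  - rewrite Q3, Y2, Q1 by lia. exact A3.
  - exact Y3.
  - rewrite Q3, Q2 by lia. exact Y1.
  - intros j. destruct (Ht j) as (? & ? & E). rewrite Q3, Q2, Q1 by lia. exact E.
  - destruct (exec_copy (fr + 2) out (fr + 3) s4) as (s5 & X5 & Y5 & Q5); [lia..|].
    exists s5. split; [repeat (eapply exec_seq; eauto)|].
    split; [congruence|].
    intros q H1 H2. rewrite Q5, Q4, Q3, Q2, Q1 by lia. reflexivity.
Qed.

(** Register [fr] holds the candidate and [fr + 1] the value of [f] there; the loop only tests
    [fr + 1], which each pass overwrites. *)
Lemma compiled_min n (f : recfun (S n)) v w y :
  (forall m, m < y -> compiled f (m :: v)%vector (S (w m))) ->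
  compiled f (y :: v)%vector 0 -> compiled (RMin f) v y.
Proof.
  intros Hw Hy args out fr s Hargs Hout. cbn [compile].
  assert (F : forall m u s, compiled f (m :: v)%vector u -> s fr = m ->
    (forall i, s (Vector.nth args i) = Vector.nth v i) ->
    exists s', exec (compile f (fr :: args)%vector (fr + 1) (fr + 2)) s s' /\
      s' (fr + 1) = u /\ forall q, q <= fr -> s' q = s q).
  { intros m u s0 Hf E1 E2.
    destruct (Hf (fr :: args)%vector (fr + 1) (fr + 2) s0) as (s1 & X1 & Y1 & Q1).
    { intros i. apply (Fin.caseS' i); cbn; [lia|].
      clear i. intros i. specialize (Hargs i). rewrite E2. lia. }
    { lia. }
    exists s1. split; [exact X1|]. split; [exact Y1|].
    intros q Hq. apply Q1; lia. }
  assert (L : forall c m s, m + c = y -> s fr = m ->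
    (m < y -> s (fr + 1) = S (w m)) -> (m = y -> s (fr + 1) = 0) ->
    (forall i, s (Vector.nth args i) = Vector.nth v i) ->
    exists s', exec (Loop (fr + 1)
      (Seq (Inc fr) (compile f (fr :: args)%vector (fr + 1) (fr + 2)))) s s' /\
      s' fr = y /\ forall q, q < fr -> s' q = s q).
  { induction c as [|c IH]; intros m s0 E1 E2 E3 E4 E5.
    - exists s0. split; [apply exec_loop0, E4; lia|]. split; [lia|auto].
    - set (s1 := upd s0 (fr + 1) (w m)).
      set (s2 := upd s1 fr (S (s1 fr))).
      assert (Q2 : forall q, q < fr -> s2 q = s0 q).
      { intros q Hq. unfold s2, s1. now rewrite !upd_neq by lia. }
      assert (V2 : s2 fr = S m).
      { unfold s2. rewrite upd_eq. unfold s1. rewrite upd_neq by lia. lia. }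
      assert (A2 : forall i, s2 (Vector.nth args i) = Vector.nth v i).
      { intros i. rewrite Q2; [apply E5|]. apply Hargs. }
      assert (exists u, compiled f (S m :: v)%vector u /\
        (S m < y -> u = S (w (S m))) /\ (S m = y -> u = 0)) as (u & U1 & U2 & U3).
      { destruct (Nat.eq_dec (S m) y) as [e|e].
        - exists 0. rewrite e. repeat split; auto; lia.
        - exists (S (w (S m))). repeat split; try (intros; lia). apply Hw. lia. }
      destruct (F (S m) u s2 U1 V2 A2) as (s3 & X3 & Y3 & Q3).
      destruct (IH (S m) s3) as (s' & X & Y & Q).
      + lia.
      + rewrite Q3 by lia. exact V2.
      + intros l. rewrite Y3. auto.
      + intros l. rewrite Y3. auto.
      + intros i. rewrite Q3; [apply A2|]. specialize (Hargs i). lia.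
      + exists s'. split.
        { eapply exec_loopS; [apply E3; lia| |exact X].
          eapply exec_seq; [apply exec_inc|exact X3]. }
        split; [exact Y|]. intros q Hq. rewrite Q, Q3, Q2 by lia. reflexivity. }
  destruct (exec_clear fr s) as (s1 & X1 & Y1 & Q1).
  assert (A1 : forall i, s1 (Vector.nth args i) = Vector.nth v i).
  { intros i. destruct (Hargs i) as (? & ? & E). rewrite Q1 by lia. exact E. }
  assert (exists u, compiled f (0 :: v)%vector u /\
    (0 < y -> u = S (w 0)) /\ (0 = y -> u = 0)) as (u & U1 & U2 & U3).
  { destruct (Nat.eq_dec 0 y) as [e|e].
    - exists 0. subst y. repeat split; auto; lia.
    - exists (S (w 0)). repeat split; try (intros; lia). apply Hw. lia. }
  destruct (F 0 u s1 U1 Y1 A1) as (s2 & X2 & Y2 & Q2).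
  destruct (L y 0 s2) as (s3 & X3 & Y3 & Q3).
  - reflexivity.
  - rewrite Q2 by lia. exact Y1.
  - intros l. rewrite Y2. auto.
  - intros l. rewrite Y2. auto.
  - intros i. rewrite Q2; [apply A1|]. specialize (Hargs i). lia.
  - destruct (exec_copy fr out (fr + 2) s3) as (s4 & X4 & Y4 & Q4); [lia..|].
    exists s4. split; [repeat (eapply exec_seq; eauto)|]. split; [congruence|].
    intros q H1 H2. rewrite Q4, Q3, Q2, Q1 by lia. reflexivity.
Qed.

(** The derivation of a primitive recursion builds the course of values from the
    outside in, whereas the compiled loop runs from the inside out; hence the
    stronger induction predicate. *)
Definition course {n} (f : recfun n) : Vector.t nat n -> nat -> Prop :=
  match f in recfun n return Vector.t nat n -> nat -> Prop with
  | RPrec f g => fun v y => exists z,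
      compiled f (Vector.tl v) (z 0) /\
      (forall i, i < Vector.hd v ->
         compiled g (i :: z i :: Vector.tl v)%vector (z (S i))) /\
      z (Vector.hd v) = y
  | _ => fun _ _ => True
  end.

Lemma compile_correct n (f : recfun n) v y : eval f v y -> compiled f v y.
Proof.
  intros H. enough (compiled f v y /\ course f v y) by tauto.
  induction H as [|x|n i v|k n f gs v w y _ IHgs _ IHf|n f g v y _ IHf
    |n f g m v z y _ IH _ IHg|n f v w y _ IHw _ IHy].
  - split; [|exact I]. intros args out fr s _ Hout.
    destruct (exec_clear out s) as (s' & X & Y & Q). exists s'. auto.
  - split; [|exact I]. intros args out fr s Hargs Hout.
    destruct (Hargs Fin.F1) as (A1 & A2 & A3). rewrite <- nth_hd in A1, A2, A3.
    destruct (exec_copy (Vector.hd args) out fr s) as (s1 & X & Y & Q); [lia..|].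
    eexists. split; [eapply exec_seq; [exact X|apply exec_inc]|].
    split; [rewrite upd_eq; cbn in A3; congruence|].
    intros q H1 H2. rewrite upd_neq, Q by lia. reflexivity.
  - split; [|exact I]. intros args out fr s Hargs Hout.
    destruct (Hargs i) as (A1 & A2 & A3).
    destruct (exec_copy (Vector.nth args i) out fr s) as (s1 & X & Y & Q); [lia..|].
    exists s1. split; [exact X|]. split; [congruence|].
    intros q H1 H2. apply Q; lia.
  - split; [|exact I]. eapply compiled_comp; [intros i; apply IHgs|apply IHf].
  - split.
    + apply (compiled_prec n f g v 0 (fun _ => y)); [apply IHf|lia].
    + exists (fun _ => y). cbn. split; [apply IHf|]. split; [lia|reflexivity].
  - destruct IH as [_ (c & C1 & C2 & C3)]. cbn in C1, C2, C3.
    assert (exists c', compiled f v (c' 0) /\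
      (forall i, i < S m -> compiled g (i :: c' i :: v)%vector (c' (S i))) /\
      c' (S m) = y) as (c' & D1 & D2 & D3).
    (* The course up to [m] is prolonged by the new value [y] at [S m]. *)
    { exists (fun i => if i <=? m then c i else y). split; [exact C1|]. split.
      - intros i Hi. replace (i <=? m) with true by (symmetry; apply Nat.leb_le; lia).
        destruct (Nat.leb_spec (S i) m).
        + apply C2. lia.
        + replace i with m by lia. rewrite C3. apply IHg.
      - now replace (S m <=? m) with false by (symmetry; apply Nat.leb_gt; lia). }
    split; [rewrite <- D3; now apply compiled_prec|].
    exists c'. auto.
  - split; [|exact I].
    eapply compiled_min; [intros m Hm; apply (IHw m Hm)|apply IHy].
Qed.

(** * Register machines and the assembly of loop programs *)

Inductive instr : Set :=
| INC : nat -> instr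
| DEC : nat -> nat -> instr
| JMP : nat -> instr.

Inductive step (P : list instr) : nat * state -> nat * state -> Prop :=
| step_inc pc r s : nth_error P pc = Some (INC r) ->
    step P (pc, s) (S pc, upd s r (S (s r)))
| step_dec0 pc r j s : nth_error P pc = Some (DEC r j) -> s r = 0 ->
    step P (pc, s) (j, s)
| step_decS pc r j m s : nth_error P pc = Some (DEC r j) -> s r = S m ->
    step P (pc, s) (S pc, upd s r m)
| step_jmp pc j s : nth_error P pc = Some (JMP j) -> step P (pc, s) (j, s).

Definition steps P := clos_refl_trans_1n _ (step P).

Lemma steps_trans P c1 c2 c3 : steps P c1 c2 -> steps P c2 c3 -> steps P c1 c3.
Proof.
  intros H1 H2. induction H1; [exact H2|].
  eapply Relation_Operators.rt1n_trans; [eassumption|]. now apply IHclos_refl_trans_1n.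
Qed.

Lemma steps_step P c1 c2 : step P c1 c2 -> steps P c1 c2.
Proof. intros H. eapply Relation_Operators.rt1n_trans; [exact H|apply rt1n_refl]. Qed.

Lemma step_deterministic P c c1 c2 : step P c c1 -> step P c c2 -> c1 = c2.
Proof.
  intros H1 H2.
  destruct H1; inversion H2; subst; clear H2; try congruence;
    match goal with
    | A : nth_error P ?pc = Some _, B : nth_error P ?pc = Some _ |- _ =>
        rewrite A in B; inversion B; subst
    end; congruence.
Qed.

(** By determinism one of the two runs continues the other, and no step starts at an address outside
    the program. This excludes acceptance once the machine has stopped elsewhere. *)
Lemma stuck_unique P c c1 c2 :
  steps P c c1 -> steps P c c2 ->
  nth_error P (fst c1) = None -> nth_error P (fst c2) = None -> c1 = c2.
Proof.
  assert (N : forall c c', nth_error P (fst c) = None -> ~ step P c c').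
  { intros c0 c' E H. destruct H; cbn in E; congruence. }
  intros H. revert c2.
  induction H as [c|c d c1 H1 H2 IH]; intros c2 H E1 E2;
    destruct H as [|d' c2 H3 H4].
  - reflexivity.
  - now apply N in H3.
  - now apply N in H1.
  - apply IH; auto. now rewrite (step_deterministic _ _ _ _ H1 H3).
Qed.

(** Jumps are absolute, so [b] tells where the code is placed. A loop consists of a test, the body
    and a jump back; the test exits to the address after that jump, hence the [+ 2]. *)
Fixpoint assemble (c : prog) (b : nat) : list instr :=
  match c with
  | Skip => []
  | Inc r => [INC r]
  | Seq c d => let l := assemble c b in l ++ assemble d (b + length l)
  | Loop r c =>
      let l := assemble c (S b) in
      DEC r (b + length l + 2) :: l ++ [JMP b]
  end.

(** The surrounding code is arbitrary because the code of a subprogram runs inside that of the whole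
    program. *)
Lemma assemble_correct c s s' :
  exec c s s' -> forall pre post,
  steps (pre ++ assemble c (length pre) ++ post) (length pre, s)
    (length pre + length (assemble c (length pre)), s').
Proof.
  assert (At : forall (pre post : list instr) x,
    nth_error (pre ++ x :: post) (length pre) = Some x).
  { intros. rewrite nth_error_app2, Nat.sub_diag; auto. }
  induction 1 as [s|r s|c d s1 s2 s3 _ IH1 _ IH2|r c s E|r c m s1 s2 s3 E _ IH1 _ IH2];
    intros pre post.
  - cbn. rewrite Nat.add_0_r. apply rt1n_refl.
  - cbn [assemble app length]. rewrite Nat.add_1_r.
    apply steps_step, step_inc, At.
  - cbn [assemble]. rewrite length_app.
    set (l := assemble c (length pre)) in *.
    eapply steps_trans.
    + rewrite <- app_assoc. apply (IH1 pre).
    + specialize (IH2 (pre ++ l) post). rewrite length_app in IH2.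
      rewrite Nat.add_assoc, <- app_assoc, (app_assoc pre). exact IH2.
  - cbn [assemble].
    set (l := assemble c (S (length pre))).
    replace (length pre + length (_ :: _)) with (length pre + length l + 2)
      by (cbn [length]; rewrite length_app; cbn; lia).
    apply steps_step. eapply step_dec0; [apply At|exact E].
  - specialize (IH2 pre post). cbn [assemble] in *.
    set (l := assemble c (S (length pre))) in *.
    set (jz := DEC r (length pre + length l + 2)) in *.
    eapply steps_trans; [|exact IH2].
    eapply Relation_Operators.rt1n_trans; [eapply step_decS; [apply At|exact E]|].
    specialize (IH1 (pre ++ [jz]) (JMP (length pre) :: post)).
    rewrite length_app in IH1. cbn [length] in IH1. rewrite Nat.add_1_r in IH1.
    fold l in IH1. rewrite <- app_assoc in IH1. cbn [app] in IH1 |- *.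
    rewrite <- app_assoc. cbn [app].
    eapply steps_trans; [exact IH1|].
    apply steps_step, step_jmp.
    replace (pre ++ jz :: l ++ JMP (length pre) :: post)
      with ((pre ++ jz :: l) ++ JMP (length pre) :: post)
      by (rewrite <- app_assoc; reflexivity).
    rewrite <- (At (pre ++ jz :: l) post). f_equal.
    rewrite length_app. cbn [length]. lia.
Qed.

Definition start (n : nat) : state := fun r => if r =? 0 then n else 0.

(** A last [DEC] on the output register separates the results: zero jumps to [yes], anything else
    falls through to [no], and both addresses lie beyond the end of the program. *)
Lemma recfun_machine (g : recfun 1) :
  exists P no yes,
    nth_error P no = None /\ nth_error P yes = None /\ no <> yes /\
    forall n y, eval g [n]%vector y ->
      exists s, steps P (0, start n) (if y =? 0 then yes else no, s).
Proof.
  set (c := compile g [0]%vector 1 2). set (l := assemble c 0).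
  set (P := l ++ [DEC 1 (length l + 2)]).
  exists P, (length l + 1), (length l + 2).
  assert (L : length P = length l + 1)
    by (unfold P; rewrite length_app; reflexivity).
  split; [apply nth_error_None; lia|]. split; [apply nth_error_None; lia|].
  split; [lia|].
  intros n y H. apply compile_correct in H.
  destruct (H [0]%vector 1 2 (start n)) as (s & X & Y & _).
  { intros i. apply (Fin.caseS' i); cbn; [auto with arith|].
    clear i. intros i. apply (Fin.case0 (fun _ => _) i). }
  { lia. }
  pose proof (assemble_correct _ _ _ X [] [DEC 1 (length l + 2)]) as R.
  cbn [app length Nat.add] in R. fold c l P in R.
  assert (At : nth_error P (length l) = Some (DEC 1 (length l + 2))).
  { unfold P. rewrite nth_error_app2, Nat.sub_diag; auto. }
  destruct y as [|y]; eexists; (eapply steps_trans; [exact R|]);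
    apply steps_step; cbn [Nat.eqb].
  - eapply step_dec0; eauto.
  - rewrite Nat.add_1_r. eapply step_decS; eauto.
Qed.

(** * The formula of a register machine *)

(** The last three speak of the value of register [r]. [One r] is the stage through which [Zero r]
    climbs the diagonal: one increment, then one decrement. *)
Inductive fact : Set :=
| State : nat -> fact
| Zero : nat -> fact
| One : nat -> fact
| Pos : nat -> fact.

(** [Gen k i]: generator of direction [k], in a position of parity [i].
    [Par k i]: the generators of direction [k] form an initial segment, whose
    length has parity [i].  [Out k i] and [End i] matter through their failure:
    [Out k i] fails only where [Par k i] should hold, and [End i] fails on a
    chain, of current parity [i], that extends forever in all directions.
    [Pend F k i]: [F] is to be asserted as soon as [Par k i] is. *)
Inductive letter : Set :=
| Gen : nat -> bool -> letter
| Par : nat -> bool -> letter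
| Out : nat -> bool -> letter
| End : bool -> letter
| Root : letter
| Halt : letter
| Fact : fact -> letter
| Pend : fact -> nat -> bool -> letter.

Definition fact_code (F : fact) : nat * nat :=
  match F with
  | State q => (0, q)
  | Zero r => (1, r)
  | One r => (2, r)
  | Pos r => (3, r)
  end.

Definition letter_code (a : letter) : nat :=
  let pack t F k i :=
    to_nat (t, to_nat (to_nat F, to_nat (k, Nat.b2n i))) in
  match a with
  | Gen k i => pack 0 (0, 0) k i
  | Par k i => pack 1 (0, 0) k i
  | Out k i => pack 2 (0, 0) k i
  | End i => pack 3 (0, 0) 0 i
  | Root => pack 4 (0, 0) 0 false
  | Halt => pack 5 (0, 0) 0 false
  | Fact F => pack 6 (fact_code F) 0 false
  | Pend F k i => pack 7 (fact_code F) k i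
  end.

Lemma fact_code_inj F G : fact_code F = fact_code G -> F = G.
Proof. destruct F, G; cbn; congruence. Qed.

Lemma letter_code_inj a b : letter_code a = letter_code b -> a = b.
Proof.
  assert (pair_inj : forall a b c d,
    to_nat (a, b) = to_nat (c, d) -> a = c /\ b = d).
  { intros x y z u E. apply to_nat_inj in E. now inversion E. }
  assert (J : forall t F k i t' F' k' i',
    to_nat (t, to_nat (to_nat F, to_nat (k, Nat.b2n i))) =
    to_nat (t', to_nat (to_nat F', to_nat (k', Nat.b2n i'))) ->
    t = t' /\ F = F' /\ k = k' /\ i = i').
  { intros t F k i t' F' k' i' E.
    apply pair_inj in E as [Et E]. apply pair_inj in E as [EF E].
    apply pair_inj in E as [Ek Ei].
    apply to_nat_inj in EF. apply Nat.b2n_inj in Ei. auto. }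
  destruct a, b; unfold letter_code; intros E; apply J in E;
    destruct E as (Et & EF & Ek & Ei); try discriminate Et;
    try apply fact_code_inj in EF; subst; reflexivity.
Qed.

Opaque letter_code.

Definition letter_var (a : letter) : formula := Var (letter_code a).
Coercion letter_var : letter >-> formula.
Coercion Fact : fact >-> letter.

Declare Scope formula_scope.
Local Open Scope formula_scope.
Local Notation "a ⇒ b" := (Imp a b) (at level 70, right associativity) : formula_scope.
Local Notation "a ∧ b" := (And a b) (at level 50, left associativity) : formula_scope.
Local Notation "a ∨ b" := (Or a b) (at level 60, right associativity) : formula_scope.

(** The empty conjunction is only meant to be evaluated at [zero]. *)
Fixpoint big_and {A} (l : list A) (F : A -> formula) : formula :=
  match l with
  | [] => Root ⇒ Root
  | a :: l => F a ∧ big_and l F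
  end.

Definition extend (ks : list nat) (i : bool) (phi : formula) : formula :=
  fold_right (fun k psi => Gen k i ⇒ psi) phi ks.

Definition parities : list bool := [false; true].

(** Joining a generator may fail to be a proper step, so [F] has to depend on the parity having
    changed. An implication speaks of joins rather than of the point itself, so the letter
    [Pend F k] stands for this local condition. *)
Definition move (phi : formula) (k : nat) (F : fact) : formula :=
  big_and parities (fun i =>
    (phi ∧ Par k i ⇒ Gen k i ⇒ Pend F k (negb i)) ∧
    (Pend F k i ∧ Par k i ⇒ F)).

Definition dims (K : nat) : list nat := seq 0 (2 * K).

Definition other (K k : nat) : list nat :=
  filter (fun l => negb (l =? k)) (dims K).

Definition unrelated (K r : nat) : list nat :=
  filter (fun l => negb (Nat.div2 l =? r)) (dims K).

(** [Out k i ⇒ Out k i] has content: satisfied at [v], it carries [Out k i] from any [z] to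
    [join v z]; [State 0 ⇒ State 0] in [axioms] acts likewise. [Out k i] spreads in the directions
    other than [k], and so from an axis to the diagonal, where it meets the failure of [End i]. *)
Definition grid_axioms (K : nat) : formula :=
  big_and parities (fun i =>
    (extend (dims K) i (End (negb i)) ⇒ End i) ∧ (Halt ⇒ End i) ∧
    big_and (dims K) (fun k =>
      (Halt ⇒ Gen k i ⇒ Halt) ∧
      (Root ⇒ Par k false) ∧
      (Out k i ⇒ Out k i) ∧
      (Out k i ⇒ End i) ∧
      (Par k i ⇒ Gen k i ⇒ Par k (negb i) ∨ Out k (negb i)) ∧
      big_and (other K k) (fun l => big_and parities (fun j =>
        (Par k i ⇒ Gen l j ⇒ Par k i) ∧ (Out k i ⇒ Gen l j ⇒ Out k i))))).

(** The value of register [r] is the number of steps made in direction [2 * r]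
    minus the number of steps made in direction [2 * r + 1]. *)
Definition register_axioms (K r : nat) : formula :=
  (Root ⇒ Zero r) ∧
  big_and (unrelated K r) (fun l => big_and parities (fun j => Zero r ⇒ Gen l j ⇒ Zero r)) ∧
  move (Zero r) (2 * r) (One r) ∧
  move (One r) (2 * r + 1) (Zero r) ∧
  (One r ⇒ Pos r) ∧
  move (Pos r) (2 * r) (Pos r).

Definition instr_axioms (pc : nat) (c : instr) : formula :=
  match c with
  | INC r => move (State pc) (2 * r) (State (S pc))
  | DEC r j =>
      (State pc ∧ Zero r ⇒ State j) ∧
      move (State pc ∧ Pos r) (2 * r + 1) (State (S pc))
  | JMP j => State pc ⇒ State j
  end.

Definition axioms (K : nat) (P : list instr) (yes : nat) : formula :=
  grid_axioms K ∧ big_and (seq 0 K) (register_axioms K) ∧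
  (State 0 ⇒ State 0) ∧ (State yes ⇒ Halt) ∧
  big_and (seq 0 (length P)) (fun pc => instr_axioms pc (nth pc P (JMP pc))).

Definition machine_formula (K : nat) (P : list instr) (yes : nat) : formula :=
  axioms K P yes ⇒ End false.

(** Only the conjunct with the parity of coordinate 0 makes a demand; in the model the other holds
    by its first [Out 0]. The inner [Out 0] excuses improper steps. As [phi] occurs twice, iteration
    yields exponential size, harmless since only computability matters. *)
Definition input_step (phi : formula) : formula :=
  (Out 0 false ∨ (Gen 0 false ⇒ Out 0 true ∨ phi)) ∧
  (Out 0 true ∨ (Gen 0 true ⇒ Out 0 false ∨ phi)).

(** Starts the machine [n] steps away from the root in direction [0]. *)
Definition input_formula (n : nat) : formula :=
  Root ∧ Nat.iter n input_step (State 0).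

(** [input_step] acts on codes by a fixed computable map, so the code of the iterated formula is an
    iterate of that map. *)
Lemma computable_input_code :
  computable (fun n => code (input_formula n)).
Proof.
  set (c := fun a : letter => code a).
  set (node := fun t x y => 4 * to_nat (x, y) + t).
  set (step := fun x =>
    node 1 (node 2 (c (Out 0 false)) (node 3 (c (Gen 0 false)) (node 2 (c (Out 0 true)) x)))
           (node 2 (c (Out 0 true)) (node 3 (c (Gen 0 true)) (node 2 (c (Out 0 false)) x)))).
  assert (H : computable (fun n => node 1 (c Root) (Nat.iter n step (c (State 0))))).
  { apply computable_node; [apply computable_const|]. apply computable_iter.
    repeat (apply computable_node || apply computable_const || apply computable_id). }
  destruct H as [f H]. exists f. intros n. specialize (H n).
  replace (code (input_formula n)) with (node 1 (c Root) (Nat.iter n step (c (State 0)))).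
  { exact H. }
  unfold input_formula. cbn [code]. unfold node. do 3 f_equal.
  f_equal. clear H. induction n as [|n IH]; [reflexivity|].
  cbn [Nat.iter nat_rect]. unfold Nat.iter in IH. rewrite IH. reflexivity.
Qed.

Lemma sat_and {S : semilattice_frame} (V : nat -> S -> Prop) x a b :
  sat V x (a ∧ b) <-> sat V x a /\ sat V x b.
Proof. reflexivity. Qed.

Lemma big_and_elim {S : semilattice_frame} (V : nat -> S -> Prop) x {A} (l : list A) F :
  sat V x (big_and l F) -> forall a, In a l -> sat V x (F a).
Proof.
  induction l as [|b l IH]; cbn; [tauto|].
  intros [H1 H2] a [<-|Ha]; auto.
Qed.

Lemma big_and_zero {S : semilattice_frame} (V : nat -> S -> Prop) {A} (l : list A) F :
  (forall a, In a l -> sat V zero (F a)) -> sat V zero (big_and l F).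
Proof.
  induction l as [|b l IH]; intros H; cbn.
  - intros y Hy. now rewrite join_zero.
  - split; [apply H; now left|]. apply IH. intros a Ha. apply H. now right.
Qed.

Lemma in_parities i : In i parities.
Proof. destruct i; cbn; auto. Qed.

Lemma in_dims K k : In k (dims K) <-> k < 2 * K.
Proof. unfold dims. rewrite in_seq. lia. Qed.

Lemma in_other K k l : In l (other K k) <-> l < 2 * K /\ l <> k.
Proof.
  unfold other. rewrite filter_In, in_dims, negb_true_iff, Nat.eqb_neq. tauto.
Qed.

Lemma in_unrelated K r l : In l (unrelated K r) <-> l < 2 * K /\ Nat.div2 l <> r.
Proof.
  unfold unrelated. rewrite filter_In, in_dims, negb_true_iff, Nat.eqb_neq. tauto.
Qed.

(** * Semilattices *)

Section Semilattice.

Context {L : semilattice_frame}.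

Definition joins (l : list L) : L := fold_right join zero l.

Definition leq (x y : L) : Prop := join x y = y.

Lemma join_zero_r (x : L) : join x zero = x.
Proof. rewrite join_comm. apply join_zero. Qed.

Lemma leq_refl x : leq x x.
Proof. apply join_idem. Qed.

Lemma leq_trans x y z : leq x y -> leq y z -> leq x z.
Proof. unfold leq. intros H1 H2. rewrite <- H2, join_assoc. now rewrite H1. Qed.

Lemma leq_antisym x y : leq x y -> leq y x -> x = y.
Proof. unfold leq. intros H1 H2. rewrite <- H2, join_comm. exact H1. Qed.

Lemma leq_join_l x y : leq x (join x y).
Proof. unfold leq. now rewrite join_assoc, join_idem. Qed.

Lemma leq_join_r x y : leq y (join x y).
Proof. rewrite join_comm. apply leq_join_l. Qed.

Lemma join_lub x y u : leq x u -> leq y u -> leq (join x y) u.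
Proof. unfold leq. intros H1 H2. now rewrite <- join_assoc, H2. Qed.

Lemma leq_joins l x : In x l -> leq x (joins l).
Proof.
  induction l as [|y l IH]; cbn; [tauto|]. intros [->|H].
  - apply leq_join_l.
  - eapply leq_trans; [now apply IH|apply leq_join_r].
Qed.

Lemma joins_lub l u : (forall x, In x l -> leq x u) -> leq (joins l) u.
Proof.
  induction l as [|y l IH]; cbn; intros H.
  - apply join_zero.
  - apply join_lub; auto.
Qed.

(** The nested implications choose one generator per direction in turn; as [ks] has no repetitions,
    the choices fit into a single function [w]. *)
Lemma sat_extend (V : nat -> L -> Prop) ks i phi z : NoDup ks ->
  sat V z (extend ks i phi) <->
  forall w : nat -> L, (forall k, In k ks -> sat V (w k) (Gen k i)) ->
    sat V (join z (joins (map w ks))) phi.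
Proof.
  intros N. revert z. induction N as [|k ks Hk N IH]; intros z; cbn.
  - rewrite join_zero_r. split; [auto|]. intros H. apply (H (fun _ => zero)). tauto.
  - split.
    + intros H w Hw. rewrite join_assoc. apply IH.
      * apply H, Hw. auto.
      * intros l Hl. apply Hw. auto.
    + intros H y Hy. apply IH. intros w Hw.
      specialize (H (fun l => if l =? k then y else w l)). cbn in H.
      rewrite Nat.eqb_refl, join_assoc in H.
      rewrite (map_ext_in (fun l => if l =? k then y else w l) w) in H.
      * apply H. intros l [<-|Hl]; [now rewrite Nat.eqb_refl|].
        destruct (Nat.eqb_spec l k) as [->|_]; [tauto|]. now apply Hw.
      * intros l Hl. destruct (Nat.eqb_spec l k) as [->|_]; [tauto|reflexivity].
Qed.

(** The grid point with origin [o] and coordinates [a], where [w k j] is the [j]-th generator of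
    direction [k], counted from zero. *)
Definition point (D : nat) (o : L) (w : nat -> nat -> L) (a : nat -> nat) : L :=
  join o (joins (flat_map (fun k => map (w k) (seq 0 (a k))) (seq 0 D))).

Section Grid.

Variables (D : nat) (o : L) (w : nat -> nat -> L).

Local Notation pt := (point D o w).

Lemma point_lub a u :
  leq o u -> (forall k j, k < D -> j < a k -> leq (w k j) u) -> leq (pt a) u.
Proof.
  intros Ho H. apply join_lub; [exact Ho|]. apply joins_lub.
  intros x Hx. apply in_flat_map in Hx as (k & Hk & Hx).
  apply in_map_iff in Hx as (j & <- & Hj). apply in_seq in Hk, Hj.
  apply H; lia.
Qed.

Lemma leq_point a k j : k < D -> j < a k -> leq (w k j) (pt a).
Proof.
  intros Hk Hj. eapply leq_trans; [|apply leq_join_r]. apply leq_joins.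
  apply in_flat_map. exists k. split; [apply in_seq; lia|].
  apply in_map, in_seq. lia.
Qed.

Lemma point_ext a b : (forall k, k < D -> a k = b k) -> pt a = pt b.
Proof.
  intros H. apply leq_antisym; apply point_lub; try apply leq_join_l;
    intros k j Hk Hj; apply leq_point; auto; specialize (H k Hk); lia.
Qed.

Lemma point_zero : pt (fun _ => 0) = o.
Proof.
  apply leq_antisym; [|apply leq_join_l].
  apply point_lub; [apply leq_refl|]. lia.
Qed.

Lemma point_step a k : k < D ->
  join (pt a) (w k (a k)) = pt (upd a k (S (a k))).
Proof.
  intros Hk. apply leq_antisym.
  - apply join_lub.
    + apply point_lub; [apply leq_join_l|]. intros l j Hl Hj. apply leq_point; [exact Hl|].
      unfold upd. destruct (Nat.eqb_spec l k) as [->|]; lia.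
    + apply leq_point; [exact Hk|]. rewrite upd_eq. lia.
  - apply point_lub.
    + eapply leq_trans; [|apply leq_join_l]. apply leq_join_l.
    + intros l j Hl. unfold upd. destruct (Nat.eqb_spec l k) as [->|]; intros Hj.
      * destruct (Nat.eq_dec j (a k)) as [->|]; [apply leq_join_r|].
        eapply leq_trans; [|apply leq_join_l]. apply leq_point; lia.
      * eapply leq_trans; [|apply leq_join_l]. now apply leq_point.
Qed.

Lemma point_diagonal m :
  join (pt (fun _ => m)) (joins (map (fun k => w k m) (seq 0 D))) =
  pt (fun _ => S m).
Proof.
  apply leq_antisym.
  - apply join_lub.
    + apply point_lub; [apply leq_join_l|]. intros. apply leq_point; lia.
    + apply joins_lub. intros x Hx. apply in_map_iff in Hx as (k & <- & Hk).
      apply in_seq in Hk. apply leq_point; lia.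
  - apply point_lub.
    + eapply leq_trans; [|apply leq_join_l]. apply leq_join_l.
    + intros k j Hk Hj. destruct (Nat.eq_dec j m) as [->|].
      * eapply leq_trans; [|apply leq_join_r]. apply leq_joins.
        apply (in_map (fun k => w k m)), in_seq. lia.
      * eapply leq_trans; [|apply leq_join_l]. apply leq_point; lia.
Qed.

(** [pt b] arises from [pt a] by joining generators in the directions where [a] and [b] differ, and
    [X] survives such joins. *)
Lemma persist (X : L -> Prop) (d : nat -> Prop) a b :
  (forall z k j, k < D -> d k -> j < b k -> leq o z -> X z -> X (join z (w k j))) ->
  (forall k, k < D -> a k <= b k) ->
  (forall k, k < D -> ~ d k -> a k = b k) ->
  X (pt a) -> X (pt b).
Proof.
  intros HX Hab Hd.
  (* Where [a] and [b] differ, all generators up to [b k] are joined; those already below [pt a] are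
     absorbed. *)
  set (c := fun k => if a k =? b k then 0 else b k).
  set (l := flat_map (fun k => map (w k) (seq 0 (c k))) (seq 0 D)).
  assert (E : pt b = join (pt a) (joins l)).
  { apply leq_antisym.
    - apply point_lub; [eapply leq_trans; apply leq_join_l|].
      intros k j Hk Hj. destruct (Nat.eqb_spec (a k) (b k)) as [e|e].
      + eapply leq_trans; [|apply leq_join_l]. apply leq_point; lia.
      + eapply leq_trans; [|apply leq_join_r]. apply leq_joins, in_flat_map.
        exists k. split; [apply in_seq; lia|]. apply in_map, in_seq.
        unfold c. apply Nat.eqb_neq in e. rewrite e. lia.
    - apply join_lub.
      + apply point_lub; [apply leq_join_l|]. intros k j Hk Hj.
        apply leq_point; [exact Hk|]. specialize (Hab k Hk). lia.
      + apply joins_lub. intros x Hx. apply in_flat_map in Hx as (k & Hk & Hx).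
        apply in_map_iff in Hx as (j & <- & Hj). apply in_seq in Hk, Hj.
        unfold c in Hj. destruct (a k =? b k); [lia|]. apply leq_point; lia. }
  rewrite E. clear E.
  assert (Hl : forall x, In x l -> exists k j, k < D /\ d k /\ j < b k /\ x = w k j).
  { intros x Hx. apply in_flat_map in Hx as (k & Hk & Hx).
    apply in_map_iff in Hx as (j & <- & Hj). apply in_seq in Hk, Hj.
    unfold c in Hj. destruct (Nat.eqb_spec (a k) (b k)) as [e|e]; [lia|].
    exists k, j. split; [lia|]. split; [|split; [lia|reflexivity]].
    apply NNPP. intros n. apply e, Hd; [lia|exact n]. }
  assert (Ho : leq o (pt a)) by apply leq_join_l.
  clearbody l. revert Ho. generalize (pt a) as z.
  induction l as [|x l IH]; intros z Ho Hz; cbn.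
  - now rewrite join_zero_r.
  - rewrite join_assoc. destruct (Hl x) as (k & j & H1 & H2 & H3 & ->); [now left|].
    apply IH.
    + intros y Hy. apply Hl. now right.
    + eapply leq_trans; [exact Ho|apply leq_join_l].
    + now apply HX.
Qed.

End Grid.

End Semilattice.

(** * A halting machine makes its formula valid *)

Definition instr_below (K : nat) (c : instr) : Prop :=
  match c with INC r | DEC r _ => r < K | JMP _ => True end.

Lemma odd_S m : Nat.odd (S m) = negb (Nat.odd m).
Proof. rewrite Nat.odd_succ. symmetry. apply Nat.negb_odd. Qed.

(** Written as a sum because subtraction on [nat] truncates. *)
Definition represents (a : nat -> nat) (s : state) : Prop :=
  forall r, s r + a (2 * r + 1) = a (2 * r).

Lemma represents_inc a s r : represents a s ->
  represents (upd a (2 * r) (S (a (2 * r)))) (upd s r (S (s r))).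
Proof.
  intros H q. specialize (H q). unfold upd.
  replace (2 * q + 1 =? 2 * r) with false by (symmetry; apply Nat.eqb_neq; lia).
  destruct (Nat.eqb_spec q r) as [->|].
  - rewrite Nat.eqb_refl. lia.
  - replace (2 * q =? 2 * r) with false by (symmetry; apply Nat.eqb_neq; lia). lia.
Qed.

Lemma represents_dec a s r m : represents a s -> s r = S m ->
  represents (upd a (2 * r + 1) (S (a (2 * r + 1)))) (upd s r m).
Proof.
  intros H E q. specialize (H q). unfold upd.
  replace (2 * q =? 2 * r + 1) with false by (symmetry; apply Nat.eqb_neq; lia).
  destruct (Nat.eqb_spec q r) as [->|].
  - rewrite Nat.eqb_refl. lia.
  - replace (2 * q + 1 =? 2 * r + 1) with false by (symmetry; apply Nat.eqb_neq; lia). lia.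
Qed.

Section Soundness.

Variables (K : nat) (P : list instr) (yes : nat).
Hypothesis (HK : 0 < K) (HP : forall c, In c P -> instr_below K c).

Context {L : semilattice_frame}.
Variables (V : nat -> L -> Prop) (u v : L).
Hypothesis (Hroot : sat V u Root) (Hax : sat V v (axioms K P yes)).

Local Notation o := (join v u).
Local Notation D := (2 * K).

Hypothesis Hend : ~ sat V o (End false).

(** An implication satisfied at [v] speaks of [join v z]; above [o], hence above [v], this is [z]
    itself, so the axioms act pointwise. *)
Lemma apply_axiom phi psi z :
  sat V v (phi ⇒ psi) -> leq o z -> sat V z phi -> sat V z psi.
Proof.
  intros H Hz Hphi. specialize (H z Hphi).
  assert (E : leq v z) by (eapply leq_trans; [apply leq_join_l|exact Hz]).
  now rewrite E in H.
Qed.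

Lemma grid_axiom i :
  sat V v (extend (dims K) i (End (negb i)) ⇒ End i) /\
  sat V v (Halt ⇒ End i) /\
  forall k, k < D ->
    sat V v (Halt ⇒ Gen k i ⇒ Halt) /\ sat V v (Root ⇒ Par k false) /\
    sat V v (Out k i ⇒ Out k i) /\ sat V v (Out k i ⇒ End i) /\
    sat V v (Par k i ⇒ Gen k i ⇒ Par k (negb i) ∨ Out k (negb i)) /\
    forall l j, l < D -> l <> k ->
      sat V v (Par k i ⇒ Gen l j ⇒ Par k i) /\
      sat V v (Out k i ⇒ Gen l j ⇒ Out k i).
Proof.
  destruct Hax as [[[[H _] _] _] _]. change (sat V v (grid_axioms K)) in H.
  destruct (big_and_elim _ _ _ _ H i (in_parities i)) as [[H1 H2] H3].
  split; [exact H1|]. split; [exact H2|].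
  intros k Hk. apply in_dims in Hk.
  destruct (big_and_elim _ _ _ _ H3 k Hk) as [[[[[A1 A2] A3] A4] A5] A6].
  repeat (split; [assumption|]). intros l j Hl Hlk.
  assert (Hl' : In l (other K k)) by (apply in_other; auto).
  pose proof (big_and_elim _ _ _ _ A6 l Hl') as B.
  exact (big_and_elim _ _ _ _ B j (in_parities j)).
Qed.

Lemma register_axiom r : r < K ->
  sat V v (Root ⇒ Zero r) /\
  (forall l j, l < D -> Nat.div2 l <> r -> sat V v (Zero r ⇒ Gen l j ⇒ Zero r)) /\
  sat V v (move (Zero r) (2 * r) (One r)) /\
  sat V v (move (One r) (2 * r + 1) (Zero r)) /\
  sat V v (One r ⇒ Pos r) /\
  sat V v (move (Pos r) (2 * r) (Pos r)).
Proof.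
  intros Hr. destruct Hax as [[[[_ H] _] _] _].
  change (sat V v (big_and (seq 0 K) (register_axioms K))) in H.
  assert (Hr' : In r (seq 0 K)) by (apply in_seq; lia).
  destruct (big_and_elim _ _ _ _ H r Hr') as [[[[[A1 A2] A3] A4] A5] A6].
  split; [exact A1|]. split; [|auto].
  intros l j Hl Hlr.
  assert (Hl' : In l (unrelated K r)) by (apply in_unrelated; auto).
  pose proof (big_and_elim _ _ _ _ A2 l Hl') as B.
  exact (big_and_elim _ _ _ _ B j (in_parities j)).
Qed.

Lemma instr_axiom pc c : nth_error P pc = Some c -> sat V v (instr_axioms pc c).
Proof.
  intros H. destruct Hax as [_ A].
  change (sat V v (big_and (seq 0 (length P))
    (fun pc => instr_axioms pc (nth pc P (JMP pc))))) in A.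
  assert (Hpc : In pc (seq 0 (length P))).
  { apply in_seq. split; [lia|]. apply nth_error_Some. congruence. }
  pose proof (big_and_elim _ _ _ _ A pc Hpc) as B. cbv beta in B.
  now rewrite (nth_error_nth _ _ _ H) in B.
Qed.

Lemma move_axiom phi k F : sat V v (move phi k F) -> forall i,
  sat V v (phi ∧ Par k i ⇒ Gen k i ⇒ Pend F k (negb i)) /\
  sat V v (Pend F k i ∧ Par k i ⇒ F).
Proof. intros H i. exact (big_and_elim _ _ _ _ H i (in_parities i)). Qed.

(** Chains of finite length are enough, since a halting run takes finitely many steps; this avoids
    choosing an infinite chain. *)
Definition generators (N : nat) (w : nat -> nat -> L) : Prop :=
  (forall k j, k < D -> j < N -> sat V (w k j) (Gen k (Nat.odd j))) /\
  forall m, m <= N -> ~ sat V (point D o w (fun _ => m)) (End (Nat.odd m)).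

(** [End] fails at the last diagonal point, so [extend] fails there too. This supplies one new
    generator in each direction and the failure of [End], with the other parity, one diagonal step
    further. *)
Lemma generators_exist N : exists w, generators N w.
Proof.
  induction N as [|N (w & Hw & Hd)].
  - exists (fun _ _ => zero). split; [lia|].
    intros m Hm. replace m with 0 by lia. now rewrite point_zero.
  - destruct (grid_axiom (Nat.odd N)) as (A & _ & _).
    assert (Ho : leq o (point D o w (fun _ => N))) by apply leq_join_l.
    assert (HN : ~ sat V (point D o w (fun _ => N))
      (extend (dims K) (Nat.odd N) (End (negb (Nat.odd N))))).
    { intros H. apply (Hd N (le_n N)). eapply apply_axiom; eauto. }
    rewrite sat_extend in HN by apply seq_NoDup.
    apply not_all_ex_not in HN as (g & HN).
    apply imply_to_and in HN as (Hg & HN).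
    set (w' := fun k j => if j =? N then g k else w k j).
    assert (E : forall m, m <= N ->
      point D o w' (fun _ => m) = point D o w (fun _ => m)).
    { intros m Hm. unfold point. do 2 f_equal. apply flat_map_ext. intros k.
      apply map_ext_in. intros j Hj. apply in_seq in Hj. unfold w'.
      destruct (Nat.eqb_spec j N); [lia|reflexivity]. }
    exists w'. split.
    + intros k j Hk Hj. unfold w'. destruct (Nat.eqb_spec j N) as [->|].
      * apply Hg, in_dims, Hk.
      * apply Hw; lia.
    + intros m Hm. destruct (Nat.eq_dec m (S N)) as [->|].
      * rewrite <- point_diagonal, E by lia. rewrite odd_S.
        rewrite (map_ext _ g); [exact HN|].
        intros k. unfold w'. now rewrite Nat.eqb_refl.
      * rewrite E by lia. apply Hd. lia.
Qed.

(** * Propagation of letters along the grid *)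

Section Grid.

Variables (N : nat) (w : nat -> nat -> L).
Hypothesis Hgen : generators N w.

Local Notation pt := (point D o w).

Definition bounded (a : nat -> nat) : Prop := forall k, k < D -> a k <= N.

Lemma grid_axiom_at phi psi a :
  sat V v (phi ⇒ psi) -> sat V (pt a) phi -> sat V (pt a) psi.
Proof. intros H. apply apply_axiom; [exact H|apply leq_join_l]. Qed.

Lemma persist_sat phi (d : nat -> Prop) a b :
  (forall k i, k < D -> d k -> sat V v (phi ⇒ Gen k i ⇒ phi)) ->
  bounded b -> (forall k, k < D -> a k <= b k) ->
  (forall k, k < D -> ~ d k -> a k = b k) ->
  sat V (pt a) phi -> sat V (pt b) phi.
Proof.
  intros H Hb. apply (persist D o w (fun z => sat V z phi) d).
  intros z k j Hk Hd Hj Hz Hphi.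
  refine (apply_axiom _ _ _ (H k (Nat.odd j) Hk Hd) Hz Hphi _ _).
  apply (proj1 Hgen); [exact Hk|]. specialize (Hb k Hk). lia.
Qed.

Lemma no_halt a : bounded a -> ~ sat V (pt a) Halt.
Proof.
  intros Ha H. apply (proj2 Hgen N (le_n N)).
  destruct (grid_axiom (Nat.odd N)) as (_ & A & _).
  apply (grid_axiom_at _ _ _ A). clear A.
  revert H. apply (persist_sat _ (fun _ => True)).
  - intros k i Hk _. destruct (grid_axiom i) as (_ & _ & B). now apply B.
  - intros k Hk. lia.
  - exact Ha.
  - tauto.
Qed.

Definition axis (k m : nat) : nat -> nat := upd (fun _ => 0) k m.

Lemma axis_step k m : k < D -> join (pt (axis k m)) (w k m) = pt (axis k (S m)).
Proof.
  intros Hk. replace (w k m) with (w k (axis k m k)) by (f_equal; apply upd_eq).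
  rewrite point_step by exact Hk. apply point_ext. intros l _.
  unfold axis, upd. rewrite Nat.eqb_refl. now destruct (l =? k).
Qed.

Lemma axis_zero k : pt (axis k 0) = o.
Proof.
  transitivity (pt (fun _ => 0)); [|apply point_zero].
  apply point_ext. intros l _.
  unfold axis, upd. now destruct (l =? k).
Qed.

(** The diagonal point with all coordinates [m] is reached from the axis point in directions other
    than [k]. [Out] persists in these and would yield [End] there. *)
Lemma axis_not_out k m : k < D -> m <= N -> ~ sat V (pt (axis k m)) (Out k (Nat.odd m)).
Proof.
  intros Hk Hm H. apply (proj2 Hgen m Hm).
  destruct (grid_axiom (Nat.odd m)) as (_ & _ & A).
  destruct (A k Hk) as (_ & _ & _ & B & _ & C).
  apply (grid_axiom_at _ _ _ B). clear B. revert H.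
  apply (persist_sat _ (fun l => l <> k)).
  - intros l j Hl Hlk. now apply C.
  - intros l Hl. lia.
  - intros l _. unfold axis, upd. destruct (l =? k); lia.
  - intros l _ Hl. unfold axis, upd.
    destruct (Nat.eqb_spec l k); [reflexivity|tauto].
Qed.

Lemma axis_par k m : k < D -> m <= N -> sat V (pt (axis k m)) (Par k (Nat.odd m)).
Proof.
  intros Hk. induction m as [|m IH]; intros Hm.
  - rewrite axis_zero. destruct (grid_axiom false) as (_ & _ & A).
    destruct (A k Hk) as (_ & B & _). exact (B u Hroot).
  - destruct (grid_axiom (Nat.odd m)) as (_ & _ & A).
    destruct (A k Hk) as (_ & _ & _ & _ & B & _).
    specialize (grid_axiom_at _ _ _ B (IH ltac:(lia)) (w k m)) as C.
    specialize (C (proj1 Hgen k m Hk Hm)).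
    rewrite axis_step, <- odd_S in C by exact Hk.
    destruct C as [C|C]; [exact C|]. now apply axis_not_out in C.
Qed.

Lemma grid_par a k : bounded a -> k < D -> sat V (pt a) (Par k (Nat.odd (a k))).
Proof.
  intros Ha Hk. generalize (axis_par k (a k) Hk (Ha k Hk)).
  apply (persist_sat _ (fun l => l <> k)); [|exact Ha| |].
  - intros l j Hl Hlk. destruct (grid_axiom (Nat.odd (a k))) as (_ & _ & A).
    now apply A.
  - intros l _. unfold axis, upd. destruct (Nat.eqb_spec l k) as [->|]; lia.
  - intros l _ Hl. unfold axis, upd.
    destruct (Nat.eqb_spec l k) as [->|]; [reflexivity|tauto].
Qed.

(** Steps along the chain are proper: [grid_par] gives the flipped parity at the new point, which
    releases the pending [F]. *)
Lemma grid_move phi k F a :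
  sat V v (move phi k F) -> k < D -> bounded (upd a k (S (a k))) ->
  sat V (pt a) phi -> sat V (pt (upd a k (S (a k)))) F.
Proof.
  intros H Hk Hb Hphi.
  assert (Ha : bounded a).
  { intros l Hl. specialize (Hb l Hl). unfold upd in Hb.
    destruct (Nat.eqb_spec l k) as [e|]; [rewrite e|]; lia. }
  assert (HN : a k < N).
  { specialize (Hb k Hk). rewrite upd_eq in Hb. lia. }
  pose proof (grid_par _ k Hb Hk) as Hpar. rewrite upd_eq, odd_S in Hpar.
  destruct (move_axiom _ _ _ H (Nat.odd (a k))) as [A _].
  destruct (move_axiom _ _ _ H (negb (Nat.odd (a k)))) as [_ B].
  apply (grid_axiom_at _ _ _ B). split; [|exact Hpar].
  rewrite <- point_step by exact Hk.
  refine (grid_axiom_at _ _ _ A _ _ _).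
  - split; [exact Hphi|]. now apply grid_par.
  - now apply (proj1 Hgen).
Qed.

Lemma grid_move_to phi k F a b :
  sat V v (move phi k F) -> k < D -> bounded b -> b k = S (a k) ->
  (forall l, l <> k -> b l = a l) ->
  sat V (pt a) phi -> sat V (pt b) F.
Proof.
  intros H Hk Hb E1 E2 Hphi.
  assert (E : forall l, upd a k (S (a k)) l = b l).
  { intros l. unfold upd. destruct (Nat.eqb_spec l k) as [->|]; auto.
    now rewrite E2. }
  rewrite <- (point_ext D o w (upd a k (S (a k))) b) by auto.
  apply (grid_move phi); auto. intros l Hl. rewrite E. now apply Hb.
Qed.

(** Induction on the common coordinate. The base points differ from the origin in unrelated
    directions only, and each diagonal step passes through [One r]. *)
Lemma grid_zero r a :
  r < K -> bounded a -> a (2 * r) = a (2 * r + 1) -> sat V (pt a) (Zero r).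
Proof.
  intros Hr. destruct (register_axiom r Hr) as (A1 & A2 & A3 & A4 & _).
  remember (a (2 * r + 1)) as m eqn:E1. revert a E1.
  induction m as [|m IH]; intros a E1 Ha E2.
  - assert (H0 : sat V (pt (fun _ => 0)) (Zero r)).
    { rewrite point_zero. exact (A1 u Hroot). }
    revert H0. apply (persist_sat _ (fun l => Nat.div2 l <> r)).
    + intros l j Hl Hlr. now apply A2.
    + exact Ha.
    + lia.
    + intros l _ Hlr. apply NNPP in Hlr.
      rewrite (Nat.div2_odd l), Hlr. destruct (Nat.odd l); cbn [Nat.b2n]; [congruence|].
      rewrite Nat.add_0_r. congruence.
  - set (b := upd a (2 * r + 1) m). set (c := upd b (2 * r) m).
    assert (Eb : b (2 * r + 1) = m) by apply upd_eq.
    assert (Eb' : b (2 * r) = S m) by (unfold b; rewrite upd_neq; lia).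
    assert (Ec : c (2 * r) = m) by apply upd_eq.
    assert (Ec' : c (2 * r + 1) = m) by (unfold c; rewrite upd_neq; lia).
    assert (Hb : bounded b).
    { intros l Hl. specialize (Ha l Hl). unfold b, upd.
      destruct (Nat.eqb_spec l (2 * r + 1)) as [->|]; lia. }
    assert (Hc : bounded c).
    { intros l Hl. specialize (Hb l Hl). unfold c, upd at 1.
      destruct (Nat.eqb_spec l (2 * r)) as [->|]; lia. }
    apply (grid_move_to _ _ _ b _ A4); [lia|exact Ha|lia| |].
    { intros l Hl. unfold b. now rewrite upd_neq. }
    apply (grid_move_to _ _ _ c _ A3); [lia|exact Hb|lia| |].
    { intros l Hl. unfold c. now rewrite upd_neq. }
    apply IH; auto; congruence.
Qed.

(** From the diagonal point with the same decrement coordinate, the first increment goes through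
    [One r] and the [p] further ones preserve [Pos r]. *)
Lemma grid_pos r p : r < K -> forall a, bounded a ->
  a (2 * r) = S (p + a (2 * r + 1)) -> sat V (pt a) (Pos r).
Proof.
  intros Hr. destruct (register_axiom r Hr) as (_ & _ & A3 & _ & A5 & A6).
  induction p as [|p IH]; intros a Ha E.
  - apply (grid_axiom_at _ _ _ A5).
    set (b := upd a (2 * r) (a (2 * r + 1))).
    assert (Eb : b (2 * r) = a (2 * r + 1)) by apply upd_eq.
    assert (Eb' : b (2 * r + 1) = a (2 * r + 1)) by (apply upd_neq; lia).
    apply (grid_move_to _ _ _ b _ A3); [lia|exact Ha|lia| |].
    { intros l Hl. unfold b. now rewrite upd_neq. }
    apply grid_zero; [exact Hr| |congruence].
    intros l Hl. specialize (Ha l Hl). unfold b, upd.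
    destruct (Nat.eqb_spec l (2 * r)) as [->|]; lia.
  - set (b := upd a (2 * r) (S (p + a (2 * r + 1)))).
    assert (Eb : b (2 * r) = S (p + a (2 * r + 1))) by apply upd_eq.
    assert (Eb' : b (2 * r + 1) = a (2 * r + 1)) by (apply upd_neq; lia).
    apply (grid_move_to _ _ _ b _ A6); [lia|exact Ha|lia| |].
    { intros l Hl. unfold b. now rewrite upd_neq. }
    apply IH; [|congruence].
    intros l Hl. specialize (Ha l Hl). unfold b, upd.
    destruct (Nat.eqb_spec l (2 * r)) as [->|]; lia.
Qed.

Lemma grid_step a pc s q s' :
  step P (pc, s) (q, s') -> represents a s -> (forall k, k < D -> a k < N) ->
  sat V (pt a) (State pc) ->
  exists b, represents b s' /\ (forall k, k < D -> b k <= S (a k)) /\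
    sat V (pt b) (State q).
Proof.
  intros H R Ha Hpc.
  assert (Hb : forall k, bounded (upd a k (S (a k)))).
  { intros k l Hl. specialize (Ha l Hl). unfold upd.
    destruct (Nat.eqb_spec l k) as [->|]; lia. }
  assert (Hle : forall k l, l < D -> upd a k (S (a k)) l <= S (a l)).
  { intros k l _. unfold upd. destruct (Nat.eqb_spec l k) as [->|]; lia. }
  assert (Ha' : bounded a) by (intros l Hl; specialize (Ha l Hl); lia).
  inversion H as [pc' r s1 A|pc' r j s1 A E|pc' r j m s1 A E|pc' j s1 A]; subst;
    pose proof (HP _ (nth_error_In _ _ A)) as Hr; cbn in Hr;
    apply instr_axiom in A; cbn [instr_axioms] in A.
  - exists (upd a (2 * r) (S (a (2 * r)))).
    split; [now apply represents_inc|]. split; [auto|].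
    eapply grid_move; eauto. lia.
  - exists a. split; [exact R|]. split; [lia|].
    apply sat_and in A as [A _]. apply (grid_axiom_at _ _ _ A). split; [exact Hpc|].
    apply grid_zero; auto. specialize (R r). lia.
  - exists (upd a (2 * r + 1) (S (a (2 * r + 1)))).
    split; [now apply represents_dec|]. split; [auto|].
    apply sat_and in A as [_ A].
    eapply grid_move; [exact A|lia|auto|].
    split; [exact Hpc|]. apply grid_pos with (p := m); auto.
    specialize (R r). lia.
  - exists a. split; [exact R|]. split; [lia|].
    now apply (grid_axiom_at _ _ _ A).
Qed.

(** Satisfaction need not persist upwards, so the input formula is followed at [z] rather than at
    [join v z]. [Out 0] with the parity of the coordinate fails at [z], as it would pass to the axis
    point [join v z]; hence each generator of the chain makes progress. *)
Lemma grid_input n : forall m z, sat V z (Nat.iter n input_step (State 0)) ->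
  join v z = pt (axis 0 m) -> m + n <= N -> sat V (pt (axis 0 (m + n))) (State 0).
Proof.
  induction n as [|n IH]; intros m z Hz E Hm.
  - rewrite Nat.add_0_r, <- E. destruct Hax as [[[_ A] _] _]. now apply A.
  - assert (H0 : 0 < D) by lia.
    set (i := Nat.odd m). set (phi := Nat.iter n input_step (State 0)) in *.
    assert (C : sat V z (Out 0 i ∨ (Gen 0 i ⇒ Out 0 (negb i) ∨ phi))).
    { destruct Hz as [H1 H2]. destruct i; [exact H2|exact H1]. }
    assert (NO : forall m z, m <= N -> join v z = pt (axis 0 m) ->
      ~ sat V z (Out 0 (Nat.odd m))).
    { intros m' z' Hm' E' H. apply (axis_not_out 0 m' H0 Hm'). rewrite <- E'.
      destruct (grid_axiom (Nat.odd m')) as (_ & _ & A).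
      destruct (A 0 H0) as (_ & _ & B & _). now apply B. }
    destruct C as [C|C]; [exfalso; revert C; apply NO; [lia|exact E]|].
    assert (E' : join v (join z (w 0 m)) = pt (axis 0 (S m))).
    { now rewrite join_assoc, E, axis_step. }
    replace (m + S n) with (S m + n) by lia.
    apply (IH _ (join z (w 0 m))); [|exact E'|lia].
    assert (HG : sat V (w 0 m) (Gen 0 i)) by (apply (proj1 Hgen); lia).
    destruct (C _ HG) as [C'|C']; [|exact C'].
    unfold i in C'. rewrite <- odd_S in C'. exfalso. revert C'.
    apply NO; [lia|exact E'].
Qed.

End Grid.

(** [T] is the length of the run, which bounds the growth of each coordinate. It is fixed before
    [N], so that a long enough chain can be chosen afterwards. *)
Lemma grid_run c d : steps P c d -> exists T, forall N w a,
  generators N w -> represents a (snd c) -> (forall k, k < D -> a k + T <= N) ->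
  sat V (point D o w a) (State (fst c)) ->
  exists b, bounded N b /\ sat V (point D o w b) (State (fst d)).
Proof.
  induction 1 as [c|[pc s] [q s'] d H _ [T IH]].
  - exists 0. intros N w a _ _ Ha Hc. exists a. split; [|exact Hc].
    intros k Hk. specialize (Ha k Hk). lia.
  - exists (S T). intros N w a G R Ha Hc.
    destruct (grid_step N w G a _ _ _ _ H R) as (b & Rb & Hb & Hq).
    + intros k Hk. specialize (Ha k Hk). lia.
    + exact Hc.
    + apply (IH N w b G Rb); [|exact Hq].
      intros k Hk. specialize (Ha k Hk). specialize (Hb k Hk). lia.
Qed.

Lemma not_refuted n s :
  steps P (0, start n) (yes, s) ->
  ~ sat V u (Nat.iter n input_step (State 0)).
Proof.
  intros H Hu. destruct (grid_run _ _ H) as (T & R).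
  destruct (generators_exist (n + T)) as (w & G).
  destruct (R (n + T) w (axis 0 n) G) as (b & Hb & Hy).
  - intros r. unfold axis, upd, start. cbn [snd].
    replace (2 * r + 1 =? 0) with false by (symmetry; apply Nat.eqb_neq; lia).
    destruct r; cbn; lia.
  - intros k _. unfold axis, upd. destruct (k =? 0); lia.
  - apply (grid_input (n + T) w G n 0 u Hu); [|lia]. now rewrite axis_zero.
  - apply (no_halt _ _ G b Hb). destruct Hax as [[_ A] _]. change (sat V v (State yes ⇒ Halt)) in A.
    exact (grid_axiom_at w _ _ _ A Hy).
Qed.

End Soundness.

Lemma halting_valid K P yes n s :
  0 < K -> (forall c, In c P -> instr_below K c) ->
  steps P (0, start n) (yes, s) ->
  semilattice_logic (input_formula n ⇒ machine_formula K P yes).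
Proof.
  intros HK HP H L V u [Hroot Hu] v Hax.
  rewrite join_zero, join_comm. apply NNPP. intros Hend.
  exact (not_refuted K P yes HK HP V u v Hroot Hax Hend n s H Hu).
Qed.

(** * A machine that halts elsewhere refutes its formula *)

(** Sets of generators, [x k j] saying that [x] contains the [j]-th generator of
    direction [k]. *)
Definition generator_sets : semilattice_frame.
Proof.
  refine (SemilatticeFrame (nat -> nat -> bool)
    (fun x y k j => x k j || y k j) (fun _ _ => false) _ _ _ _);
    intros; do 2 (apply functional_extensionality; intro).
  - apply orb_comm.
  - apply orb_assoc.
  - apply orb_diag.
  - reflexivity.
Defined.

Section Model.

Variables (K : nat) (P : list instr) (yes n : nat).
Hypothesis no_yes : forall s, ~ steps P (0, start n) (yes, s).

Local Notation M := generator_sets.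
Local Notation D := (2 * K).

Definition single (k j : nat) : M := fun l i => (l =? k) && (i =? j).

Definition row (x : M) (k m : nat) : Prop := forall j, x k j = (j <? m).

Definition diagonal (m : nat) : M := fun k j => (k <? D) && (j <? m).

(** [State q] refers to actual runs from [start n], so by [no_yes] the accepting state never
    holds. *)
Definition holds (F : fact) (x : M) : Prop :=
  match F with
  | State q => exists a s, (forall k, row x k (a k)) /\
      steps P (0, start n) (q, s) /\ represents a s
  | Zero r => exists m, row x (2 * r) m /\ row x (2 * r + 1) m
  | One r => exists m, row x (2 * r) (S m) /\ row x (2 * r + 1) m
  | Pos r => exists m p, row x (2 * r) (S (m + p)) /\ row x (2 * r + 1) m
  end.

Definition parity (k : nat) (i : bool) (x : M) : Prop :=
  exists m, row x k m /\ Nat.odd m = i.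

(** With [Out] the complement of [Par] and [Pend] a conditional at the point itself, improper steps
    satisfy the axioms for free. *)
Definition true_at (a : letter) (x : M) : Prop :=
  match a with
  | Gen k i => exists j, x = single k j /\ Nat.odd j = i
  | Par k i => parity k i x
  | Out k i => ~ parity k i x
  | End i => ~ exists m, x = diagonal m /\ Nat.odd m = i
  | Root => x = zero
  | Halt => False
  | Fact F => holds F x
  | Pend F k i => parity k i x -> holds F x
  end.

Definition valuation (p : nat) (x : M) : Prop :=
  exists a, letter_code a = p /\ true_at a x.

Local Notation "x ⊩ phi" := (sat valuation x phi) (at level 75).

Lemma sat_letter (a : letter) x : x ⊩ a <-> true_at a x.
Proof.
  split.
  - intros (b & E & H). now apply letter_code_inj in E as ->.
  - intros H. now exists a.
Qed.

Lemma sat_imp_zero phi psi :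
  (forall x, x ⊩ phi -> x ⊩ psi) -> zero ⊩ (phi ⇒ psi).
Proof. intros H x Hx. rewrite join_zero. auto. Qed.

Lemma sat_imp_gen phi (k : nat) (i : bool) psi :
  (forall x j, x ⊩ phi -> Nat.odd j = i -> join x (single k j) ⊩ psi) ->
  zero ⊩ (phi ⇒ Gen k i ⇒ psi).
Proof.
  intros H. apply sat_imp_zero. intros x Hx y Hy.
  apply sat_letter in Hy as (j & -> & Hj). auto.
Qed.

Lemma row_unique (x : M) k m m' : row x k m -> row x k m' -> m = m'.
Proof.
  intros H H'. destruct (Nat.lt_trichotomy m m') as [l|[e|l]]; [|exact e|].
  - specialize (H m). rewrite H' in H.
    apply Nat.ltb_lt in l. rewrite l, Nat.ltb_irrefl in H. discriminate.
  - specialize (H' m'). rewrite H in H'.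
    apply Nat.ltb_lt in l. rewrite l, Nat.ltb_irrefl in H'. discriminate.
Qed.

Lemma join_single_same (x : M) k j i : join x (single k j) k i = x k i || (i =? j).
Proof. cbn. unfold single. now rewrite Nat.eqb_refl. Qed.

Lemma join_single_other (x : M) k j l i : l <> k -> join x (single k j) l i = x l i.
Proof.
  intros H. cbn. unfold single. apply Nat.eqb_neq in H. rewrite H. apply orb_false_r.
Qed.

Lemma row_join_other (x : M) k j l m :
  l <> k -> row (join x (single k j)) l m <-> row x l m.
Proof.
  intros H. unfold row.
  split; intros R i; rewrite <- R; [symmetry|]; now apply join_single_other.
Qed.

(** Adding one generator either does not change the length of an initial segment
    or increases it by one, and parity tells the two cases apart. *)
Lemma row_join_same (x : M) k j m m' :
  row x k m -> row (join x (single k j)) k m' -> Nat.odd m' = negb (Nat.odd m) ->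
  m' = S m.
Proof.
  intros H H' E.
  assert (X : forall i, (i <? m') = (i <? m) || (i =? j)).
  { intros i. rewrite <- H', join_single_same. now rewrite H. }
  assert (N : m' <> m) by (intros ->; destruct (Nat.odd m); discriminate).
  assert (m <= m').
  { destruct (Nat.le_gt_cases m m') as [|l]; [assumption|exfalso].
    specialize (X m'). apply Nat.ltb_lt in l. rewrite l, Nat.ltb_irrefl in X.
    discriminate. }
  assert (j = m).
  { specialize (X m). rewrite Nat.ltb_irrefl in X.
    replace (m <? m') with true in X by (symmetry; apply Nat.ltb_lt; lia).
    symmetry in X. now apply Nat.eqb_eq in X. }
  subst j. destruct (Nat.lt_ge_cases (S m) m') as [l|l]; [exfalso|lia].
  specialize (X (S m)). apply Nat.ltb_lt in l. rewrite l in X. symmetry in X.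
  apply orb_true_iff in X as [X|X].
  - apply Nat.ltb_lt in X. lia.
  - apply Nat.eqb_eq in X. lia.
Qed.

(** [Pend] is vacuous unless the parity flips, and then [row_join_same] shows that the coordinate
    has grown by exactly one; only such steps remain to be checked. *)
Lemma sat_move phi k F :
  (forall x j m, x ⊩ phi -> row x k m -> row (join x (single k j)) k (S m) ->
     holds F (join x (single k j))) ->
  zero ⊩ move phi k F.
Proof.
  intros H. apply big_and_zero. intros i _. split.
  - apply sat_imp_gen. intros x j [Hx Hp] Hj. apply sat_letter in Hp as (m & Hm & <-).
    apply sat_letter. intros (m' & Hm' & E).
    apply (row_join_same x k j m) in E as ->; auto. now apply (H x j m).
  - apply sat_imp_zero. intros x [H1 H2]. apply sat_letter in H1, H2.
    apply sat_letter. now apply H1.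
Qed.

Lemma parity_join_other (x : M) k j l i :
  l <> k -> parity l i (join x (single k j)) <-> parity l i x.
Proof.
  intros H. split; intros (m & Hm & E); exists m; split; auto;
    now apply (row_join_other x k j l m H).
Qed.

Lemma diagonal_step (m : nat) :
  join (diagonal m) (joins (map (fun k => single k m) (dims K))) = diagonal (S m).
Proof.
  assert (J : forall ks l j,
    joins (map (fun k => single k m : M) ks) l j = existsb (Nat.eqb l) ks && (j =? m)).
  { induction ks as [|k ks IH]; intros l j; [reflexivity|].
    change (single k m l j || joins (map (fun k => single k m : M) ks) l j =
      (Nat.eqb l k || existsb (Nat.eqb l) ks) && (j =? m)).
    rewrite IH. unfold single. now destruct (l =? k), (j =? m), (existsb (Nat.eqb l) ks). }
  apply functional_extensionality. intros l. apply functional_extensionality. intros j.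
  change (diagonal m l j || joins (map (fun k => single k m : M) (dims K)) l j =
    diagonal (S m) l j).
  rewrite J. unfold diagonal.
  replace (existsb (Nat.eqb l) (dims K)) with (l <? D).
  - rewrite <- andb_orb_distrib_r. f_equal.
    destruct (Nat.ltb_spec j m), (Nat.eqb_spec j m), (Nat.ltb_spec j (S m));
      reflexivity || lia.
  - apply eq_iff_eq_true. rewrite Nat.ltb_lt, existsb_exists. split.
    + intros Hl. exists l. split; [now apply in_dims|apply Nat.eqb_refl].
    + intros (k & Hk & E). apply Nat.eqb_eq in E as ->. now apply in_dims.
Qed.

Lemma diagonal_parity k m : k < D -> parity k (Nat.odd m) (diagonal m).
Proof.
  intros Hk. exists m. split; [|reflexivity]. intros j. unfold diagonal.
  apply Nat.ltb_lt in Hk. now rewrite Hk.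
Qed.

Lemma diagonal_zero : diagonal 0 = zero.
Proof.
  apply functional_extensionality. intros k. apply functional_extensionality. intros j.
  unfold diagonal. now rewrite andb_false_r.
Qed.

Lemma row_zero k : row (zero : M) k 0.
Proof. intros j. reflexivity. Qed.

Lemma model_grid : zero ⊩ grid_axioms K.
Proof.
  apply big_and_zero. intros i _. split; [split|].
  - apply sat_imp_zero. intros x Hx. apply sat_letter. intros (m & -> & <-).
    rewrite sat_extend in Hx by apply seq_NoDup.
    (* The next generator in every direction leads to the next diagonal point. *)
    specialize (Hx (fun k => single k m)). rewrite diagonal_step in Hx.
    assert (G : diagonal (S m) ⊩ End (negb (Nat.odd m))).
    { apply Hx. intros k _. apply sat_letter. now exists m. }
    apply sat_letter in G. apply G. exists (S m). split; [reflexivity|apply odd_S].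
  - apply sat_imp_zero. intros x Hx. apply sat_letter in Hx. destruct Hx.
  - apply big_and_zero. intros k Hk. apply in_dims in Hk. repeat split.
    + apply sat_imp_zero. intros x Hx. apply sat_letter in Hx. destruct Hx.
    + apply sat_imp_zero. intros x Hx. apply sat_letter in Hx. cbn in Hx. subst x.
      apply sat_letter. exists 0. split; [apply row_zero|reflexivity].
    + now apply sat_imp_zero.
    + apply sat_imp_zero. intros x Hx. apply sat_letter in Hx. apply sat_letter.
      intros (m & -> & <-). now apply Hx, diagonal_parity.
    + apply sat_imp_gen. intros x j _ _.
      destruct (classic (parity k (negb i) (join x (single k j)))) as [H|H];
        [left|right]; now apply sat_letter.
    + apply big_and_zero. intros l Hl. apply in_other in Hl as [_ Hl].
      apply big_and_zero. intros b _.
      split; apply sat_imp_gen; intros x j Hx _; apply sat_letter in Hx; apply sat_letter.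
      * now apply parity_join_other; auto.
      * intros H. apply parity_join_other in H; auto.
Qed.

Lemma model_register r : zero ⊩ register_axioms K r.
Proof.
  assert (E : 2 * r <> 2 * r + 1) by lia.
  split; [split; [split; [split; [split|]|]|]|].
  - apply sat_imp_zero. intros x Hx. apply sat_letter in Hx. cbn in Hx. subst x.
    apply sat_letter. exists 0. split; apply row_zero.
  - apply big_and_zero. intros l Hl. apply in_unrelated in Hl as [_ Hl].
    apply big_and_zero. intros b _. apply sat_imp_gen. intros x j Hx _.
    apply sat_letter in Hx as (m & H1 & H2). apply sat_letter.
    exists m. split; apply row_join_other; auto; intros <-; apply Hl.
    + apply Nat.div2_double.
    + rewrite Nat.add_1_r. apply Nat.div2_succ_double.
  - apply sat_move. intros x j m Hx Hm Hm'. apply sat_letter in Hx as (m' & H1 & H2).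
    pose proof (row_unique _ _ _ _ H1 Hm). subst m'.
    exists m. split; [exact Hm'|]. apply row_join_other; auto.
  - apply sat_move. intros x j m Hx Hm Hm'. apply sat_letter in Hx as (m' & H1 & H2).
    pose proof (row_unique _ _ _ _ H2 Hm). subst m'.
    exists (S m). split; [|exact Hm']. apply row_join_other; auto.
  - apply sat_imp_zero. intros x Hx. apply sat_letter in Hx as (m & H1 & H2).
    apply sat_letter. exists m, 0. now rewrite Nat.add_0_r.
  - apply sat_move. intros x j m Hx Hm Hm'. apply sat_letter in Hx as (m' & p & H1 & H2).
    pose proof (row_unique _ _ _ _ H1 Hm). subst m.
    exists m', (S p). rewrite Nat.add_succ_r. split; [exact Hm'|].
    apply row_join_other; auto.
Qed.

Lemma holds_state_step (x : M) a s pc q s' :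
  (forall k, row x k (a k)) -> steps P (0, start n) (pc, s) ->
  step P (pc, s) (q, s') -> represents a s' -> holds (State q) x.
Proof.
  intros Hx Hs H R. exists a, s'. split; [exact Hx|]. split; [|exact R].
  eapply steps_trans; [exact Hs|now apply steps_step].
Qed.

Lemma rows_join (x : M) a k j :
  (forall l, row x l (a l)) -> row (join x (single k j)) k (S (a k)) ->
  forall l, row (join x (single k j)) l (upd a k (S (a k)) l).
Proof.
  intros H H' l. destruct (Nat.eq_dec l k) as [->|e].
  - now rewrite upd_eq.
  - rewrite upd_neq by exact e. now apply row_join_other.
Qed.

Lemma model_instr pc c : nth_error P pc = Some c -> zero ⊩ instr_axioms pc c.
Proof.
  intros A. destruct c as [r|r j|j]; cbn [instr_axioms].
  - apply sat_move. intros x j m Hx Hm Hm'.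
    apply sat_letter in Hx as (a & s & Ha & Hs & R).
    pose proof (row_unique _ _ _ _ (Ha (2 * r)) Hm). subst m.
    eapply holds_state_step; [now apply rows_join|exact Hs|exact (step_inc _ _ _ _ A)|].
    now apply represents_inc.
  - split.
    + apply sat_imp_zero. intros x [Hx Hz]. apply sat_letter.
      apply sat_letter in Hx as (a & s & Ha & Hs & R).
      apply sat_letter in Hz as (m & H1 & H2).
      pose proof (row_unique _ _ _ _ (Ha (2 * r)) H1).
      pose proof (row_unique _ _ _ _ (Ha (2 * r + 1)) H2).
      eapply holds_state_step; [exact Ha|exact Hs| |exact R].
      eapply step_dec0; [exact A|]. specialize (R r). lia.
    + apply sat_move. intros x j' m [Hx Hz] Hm Hm'.
      apply sat_letter in Hx as (a & s & Ha & Hs & R).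
      apply sat_letter in Hz as (m' & p & H1 & H2).
      pose proof (row_unique _ _ _ _ (Ha (2 * r)) H1).
      pose proof (row_unique _ _ _ _ (Ha (2 * r + 1)) H2).
      pose proof (row_unique _ _ _ _ (Ha (2 * r + 1)) Hm). subst m.
      assert (E : s r = S p) by (specialize (R r); lia).
      eapply holds_state_step; [now apply rows_join|exact Hs| |].
      * eapply step_decS; [exact A|exact E].
      * now apply represents_dec.
  - apply sat_imp_zero. intros x Hx. apply sat_letter.
    apply sat_letter in Hx as (a & s & Ha & Hs & R).
    eapply holds_state_step; [exact Ha|exact Hs|exact (step_jmp _ _ _ _ A)|exact R].
Qed.

Lemma model_axioms : zero ⊩ axioms K P yes.
Proof.
  split; [split; [split; [split|]|]|].
  - exact model_grid.
  - apply big_and_zero. intros r _. apply model_register.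
  - now apply sat_imp_zero.
  - apply sat_imp_zero. intros x Hx. apply sat_letter in Hx as (a & s & _ & Hs & _).
    now apply no_yes in Hs.
  - apply big_and_zero. intros pc Hpc. apply in_seq in Hpc. apply model_instr.
    now apply nth_error_nth'.
Qed.

(** For the parity of [m], a joined generator either leads to [Out 0] or is proper by
    [row_join_same]; for the other parity [Out 0] holds at once. *)
Lemma model_input_step phi m (x : M) :
  (forall y, row y 0 (S m) -> (forall k, 0 < k -> row y k 0) -> y ⊩ phi) ->
  row x 0 m -> (forall k, 0 < k -> row x k 0) -> x ⊩ input_step phi.
Proof.
  intros H H0 Hk.
  assert (G : forall i, x ⊩ Out 0 i ∨ (Gen 0 i ⇒ Out 0 (negb i) ∨ phi)).
  { intros i. destruct (bool_dec (Nat.odd m) i) as [<-|ne].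
    - right. intros y Hy. apply sat_letter in Hy as (j & -> & _).
      destruct (classic (parity 0 (negb (Nat.odd m)) (join x (single 0 j))))
        as [(m' & Hm & E)|Hn]; [right|left; now apply sat_letter].
      pose proof (row_join_same x 0 j m m' H0 Hm E). subst m'.
      apply H; [exact Hm|]. intros k Hk0. apply row_join_other; [lia|]. now apply Hk.
    - left. apply sat_letter. intros (m' & Hm & E).
      pose proof (row_unique _ _ _ _ H0 Hm). congruence. }
  split; [apply (G false)|apply (G true)].
Qed.

Lemma model_input : zero ⊩ input_formula n.
Proof.
  split; [now apply sat_letter|].
  assert (G : forall d m (x : M), m + d = n -> row x 0 m ->
    (forall k, 0 < k -> row x k 0) -> x ⊩ Nat.iter d input_step (State 0)).
  { induction d as [|d IH]; intros m x E H0 Hk.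
    - apply sat_letter. exists (fun k => if k =? 0 then n else 0), (start n).
      split; [|split].
      + intros [|k]; cbn; [|apply Hk; lia]. replace n with m by lia. exact H0.
      + apply Relation_Operators.rt1n_refl.
      + intros [|r]; cbn; lia.
    - apply (model_input_step _ m); [|exact H0|exact Hk].
      intros y. apply IH. lia. }
  apply (G n 0); [reflexivity|apply row_zero|]. intros k _. apply row_zero.
Qed.

Lemma model_refutes : ~ zero ⊩ End false.
Proof.
  intros H. apply sat_letter in H. apply H. exists 0.
  split; [symmetry; apply diagonal_zero|reflexivity].
Qed.

End Model.

Lemma stuck_invalid K P yes n :
  (forall s, ~ steps P (0, start n) (yes, s)) ->
  ~ semilattice_logic (input_formula n ⇒ machine_formula K P yes).
Proof.
  intros H V. apply (model_refutes K P n).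
  specialize (V generator_sets (valuation K P n) zero (model_input K P n)).
  specialize (V zero (model_axioms K P yes n H)).
  now rewrite !join_zero in V.
Qed.

(** * Undecidability *)

Lemma registers_bounded (P : list instr) :
  exists K, 0 < K /\ forall c, In c P -> instr_below K c.
Proof.
  induction P as [|c P (K & HK & H)].
  - exists 1. split; [lia|]. intros c [].
  - exists (K + match c with INC r | DEC r _ => S r | JMP _ => 0 end).
    split; [lia|]. intros d [<-|Hd].
    + destruct c; cbn; lia.
    + specialize (H d Hd). destruct d; cbn in *; lia.
Qed.

Theorem theorem6p2 : undecidable_logic semilattice_logic.
Proof.
  intros [f Hf].
  (* As 3 is the tag of [Imp], [d] maps [code psi] to the code of
     [input_formula (code psi) ⇒ psi]. *)
  destruct (computable_node 3 _ _ computable_input_code computable_id) as [d Hd].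
  destruct (recfun_machine (RComp f [d]%vector))
    as (P & no & yes & Sno & Syes & ne & HP).
  destruct (registers_bounded P) as (K & HK & Hbound).
  (* The machine [P] is fixed before its formula [psi], so it can be run on the code of [psi]. *)
  set (psi := machine_formula K P yes). set (m := code psi).
  set (phi := input_formula m ⇒ psi).
  assert (Run : forall y, eval f [code phi]%vector y ->
    exists s, steps P (0, start m) (if y =? 0 then yes else no, s)).
  { intros y Hy. apply HP. eapply eval_comp1; [apply Hd|exact Hy]. }
  destruct (Hf phi) as [Hvalid Hinvalid].
  destruct (classic (semilattice_logic phi)) as [H|H].
  - destruct (Run 1 (Hvalid H)) as [s Hs].
    revert H. apply stuck_invalid. intros s' Hs'.
    pose proof (stuck_unique _ _ _ _ Hs Hs' Sno Syes) as E. cbn in E. congruence.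
  - destruct (Run 0 (Hinvalid H)) as [s Hs].
    apply H. eapply halting_valid; eauto.
Qed.
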